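(* Let $\Gamma$ be a set and let $K\subset\Sigma(\Gamma)$ be a solid Corson compact space, i.e. $K$ is compact and for every $x\in K$ and every finite $A\subset\Gamma$ one has $x1_A\in K$. Then the following are equivalent: (i) $K$ is WRN; (ii) $K$ is QWRN; (iii) $K$ is Eberlein.
   Context: Compact spaces are Hausdorff. $\Sigma(\Gamma)$ is the set of all $x\in\mathbb{R}^\Gamma$ with countable support, with the topology inherited from the product $\mathbb{R}^\Gamma$. A compact space is Corson if it is homeomorphic to a compact subspace of $\Sigma(\Gamma)$ for some set $\Gamma$. A compact space is Eberlein if it is homeomorphic to a weakly compact subset of a Banach space. For $x\in\mathbb{R}^\Gamma$ and $A\subset\Gamma$, $x1_A$ is the element of $\mathbb{R}^\Gamma$ that agrees with $x$ on $A$ and is $0$ off $A$. A compact space is weakly Radon-Nikodým (WRN) if it is homeomorphic to a weak$^*$-compact subset of the dual of a Banach space which does not contain an isomorphic copy of $\ell_1$. A sequence $(A_n^0,A_n^1)_{n\in\mathbb{N}}$ of disjoint pairs of subsets of a set $S$ (i.e. $A_n^0\cap A_n^1=\emptyset$) is independent if for every $n\in\mathbb{N}$ and every $\varepsilon:\{1,\dots,n\}\to\{0,1\}$ we have $\bigcap_{k=1}^nA_k^{\varepsilon(k)}\neq\emptyset$. A family $(A_\alpha^0,A_\alpha^1)_{\alpha\in I}$ of disjoint pairs contains an independent sequence if there is a sequence $(\alpha_n)_{n\in\mathbb{N}}$ in $I$ such that $(A_{\alpha_n}^0,A_{\alpha_n}^1)_{n\in\mathbb{N}}$ is independent. A compact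 space $K$ is quasi WRN (QWRN) if there exist a set $\Lambda$ and a homeomorphic embedding of $K$ in $[0,1]^\Lambda$ such that for every $\varepsilon>0$ there exists a decomposition $\Lambda=\bigcup_{n\in\mathbb{N}}\Lambda_n^\varepsilon$ such that for all reals $p<q$ with $q-p>\varepsilon$ and every $n\in\mathbb{N}$, the family of pairs $(A_\alpha^0,A_\alpha^1)_{\alpha\in\Lambda_n^\varepsilon}$ does not contain independent sequences, where $A_\alpha^0=\{x\in K:x_\alpha<p\}$, $A_\alpha^1=\{x\in K:x_\alpha>q\}$, and $x_\alpha$ denotes the $\alpha$-th coordinate of the image of $x$ under the embedding. *)

(* Defs.v *)
From mathcomp Require Import all_boot all_order all_algebra.
From mathcomp Require Import all_classical all_reals all_analysis.
Import Order.TTheory GRing.Theory Num.Theory.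
Import numFieldNormedType.Exports.

Set Implicit Arguments.
Unset Strict Implicit.
Unset Printing Implicit Defensive.

Local Open Scope classical_set_scope.
Local Open Scope ring_scope.

Definition homeomorphism (S T : topologicalType) (f : S -> T) : Prop :=
  exists g : T -> S, [/\ cancel f g, cancel g f, continuous f & continuous g].

Definition homeomorphic (S T : topologicalType) : Prop :=
  exists f : S -> T, homeomorphism f.

Definition Sigma_product (R : realType) (Gamma : Type) : set {ptws Gamma -> R} :=
  [set x | countable [set i | x i != 0]].
Arguments Sigma_product : clear implicits.

Definition solid (R : realType) (Gamma : Type) (K : set {ptws Gamma -> R}) : Prop :=
  forall x, K x ->
  forall A : set Gamma, finite_set A -> K (patch (fun=> 0) A x).

(* The subspace topology inherited by the topological dual from the product
   [{ptws V -> R}] is the topology of pointwise convergence on [V], that is,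
   the weak-star topology. *)
Definition dual (R : realType) (V : normedModType R) : set {ptws V -> R} :=
  [set f | scalar f /\ continuous (f : V -> R)].
Arguments dual {R} V.

(* [V] with the coarsest topology making every element of its dual continuous *)
Definition weak (R : realType) (V : normedModType R) : topologicalType :=
  initial_topology
    ((fun x (f : dual V) => set_val f x) : V -> {ptws dual V -> R}).

Definition Eberlein (R : realType) (K : topologicalType) : Prop :=
  exists (V : completeNormedModType R) (L : set (weak V)),
    compact L /\ homeomorphic K L.

Definition ell1 (R : realType) : set (R^nat) :=
  [set u : R^nat | cvgn [normed series u]].
Arguments ell1 : clear implicits.

Definition ell1_norm (R : realType) (u : R^nat) : R := limn [normed series u].

(* There is a linear map from ell1 to [V] that is an isomorphism onto its
   range; only its values on [ell1 R] matter. *)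
Definition contains_ell1 (R : realType) (V : normedModType R) : Prop :=
  exists2 T : R^nat -> V,
    (forall (a : R) (u v : R^nat), ell1 R u -> ell1 R v ->
       T (fun n => a * u n + v n) = a *: T u + T v) &
    exists c C : R, 0 < c /\ forall u : R^nat, ell1 R u ->
      c * ell1_norm u <= `|T u| <= C * ell1_norm u.

Definition WRN (R : realType) (K : topologicalType) : Prop :=
  exists V : completeNormedModType R, ~ contains_ell1 V /\
  exists L : set (dual V), compact L /\ homeomorphic K L.

Definition independent (S : Type) (A0 A1 : nat -> set S) : Prop :=
  forall (n : nat) (eps : 'I_n.+1 -> bool),
    \bigcap_(k in [set: 'I_n.+1]) (if eps k then A1 k else A0 k) !=set0.

Definition contains_independent (S I : Type) (J : set I) (A0 A1 : I -> set S)
    : Prop :=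
  exists2 alpha : nat -> I, (forall n, J (alpha n)) &
    independent (A0 \o alpha) (A1 \o alpha).

Definition cube (R : realType) (Lambda : Type) : set {ptws Lambda -> R} :=
  [set x | forall i, 0 <= x i <= 1].
Arguments cube : clear implicits.

Definition QWRN (R : realType) (K : topologicalType) : Prop :=
  compact [set: K] /\
  exists (Lambda : Type) (L : set {ptws Lambda -> R}) (f : K -> L),
    [/\ L `<=` cube R Lambda, homeomorphism f &
      forall eps : R, 0 < eps ->
      exists2 Lambda_ : nat -> set Lambda, \bigcup_n Lambda_ n = setT &
      forall p q : R, p < q -> eps < q - p ->
      forall n, ~ contains_independent (Lambda_ n)
        (fun alpha => [set x : K | set_val (f x) alpha < p])
        (fun alpha => [set x : K | q < set_val (f x) alpha])].

(* Main.v *)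
Require Import Defs.
From HB Require Import structures.
From mathcomp Require Import all_boot all_order all_algebra.
From mathcomp Require Import all_classical all_reals all_analysis.
From mathcomp Require Import ring lra.
Import Order.TTheory GRing.Theory Num.Theory.
Import numFieldNormedType.Exports.

Set Implicit Arguments.
Unset Strict Implicit.
Unset Printing Implicit Defensive.

Local Open Scope classical_set_scope.
Local Open Scope ring_scope.

(** Both classes of compacta are QWRN for the coordinates given by the
    functionals, respectively by the vectors: an independent sequence of vectors
    spans a copy of ell1, and an independent sequence of functionals
    contradicts the interchange of limits on a weakly compact set.

    Conversely, let [K] be solid and QWRN. A coordinate function separating
    [t e_g] from [0] still does so, by continuity, for the points vanishing on
    some finite [F] and close to [t] at [g]. A set mapping with finite values
    is countably chromatic, so countably many sets [Gam i] of indices [g]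
    suffice, in which no [g'] belongs to the [F] of another [g]. If infinitely
    many coordinates [g] in [Gam i] of a point [x] of [K] were close to [t],
    then the points [x 1_B], where [B] is a finite set of such coordinates,
    would make the corresponding coordinate functions independent. Hence the
    bumps of the coordinates in [Gam i] around rationals are a countable union
    of point-finite families on [K] that separates its points.

    With weights tending to [0] the bumps embed [K] weakly into c_0. They also
    embed [K] into the dual of the closed span [V] of the bumps in the bounded
    functions on [nat * K]: a bounded sequence of [V] has differences that tend
    to [0] pointwise, hence by Simons' argument differences with convex
    combinations tending to [0] in norm, so [V] contains no copy of ell1. *)

(** * Continuous functions and compact spaces *)

Section real_functions.
Context {R : realType}.

Lemma continuous_ptws (T : topologicalType) (I : Type) (U : topologicalType)
    (f : T -> {ptws I -> U}) :
  (forall i, continuous (fun t => f t i)) -> continuous f.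
Proof.
move=> fc t; apply/cvg_sup => i; exact: (continuous_comp_initial (fc i)).
Qed.

Lemma continuous_ptws_eval (I : Type) (U : topologicalType) (i : I) :
  continuous (fun f : {ptws I -> U} => f i).
Proof.
exact: (@proj_continuous {classic I} (fun=> U) i).
Qed.

Lemma continuous_set_val (T : topologicalType) (A : set T) :
  continuous (set_val : A -> T).
Proof. exact: initial_continuous. Qed.

Lemma continuous_set_type (S T : topologicalType) (A : set T) (f : S -> A) :
  continuous (fun s => set_val (f s)) -> continuous f.
Proof. exact: continuous_comp_initial. Qed.

Lemma compact_setT_set_type (T : topologicalType) (A : set T) :
  compact A -> compact [set: A].
Proof.
move=> cA F PF _.
have FA : (set_val @ F) A.
  by apply: (@filterS _ F _ setT) filterT => a _ /=; exact: set_valP.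
have [x [Ax clx]] := cA (set_val @ F) _ FA.
exists (SigSub (mem_set Ax)); split=> // B C FB; case=> _ [] [] O oO <- Ox OC.
have [||y [[b Bb <-] Oy]] := clx (set_val @` B) O.
- by apply: (@filterS _ F _ B) => //; exact: preimage_image.
- exact: open_nbhs_nbhs.
by exists b; split=> //; exact: OC.
Qed.

Lemma compact_range (S T : topologicalType) (f : S -> T) :
  compact [set: S] -> continuous f -> compact (range f).
Proof.
move=> cS cf; apply: continuous_compact => //; exact: continuous_subspaceT.
Qed.

Lemma hausdorff_separating (T : topologicalType) :
  (forall x y : T, x <> y -> exists2 h : T -> R, continuous h & h x <> h y) ->
  hausdorff_space T.
Proof.
move=> sep x y clxy; apply: contrapT => /sep[h ch]; apply.
apply: (@Rhausdorff R); move=> A B /ch hA /ch hB.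
by have [z [Az Bz]] := clxy _ _ hA hB; exists (h z).
Qed.

Lemma homeomorphic_range (S T : topologicalType) (f : S -> T) :
  compact [set: S] -> hausdorff_space T -> continuous f -> injective f ->
  exists2 h : S -> range f, homeomorphism h & forall s, set_val (h s) = f s.
Proof.
move=> cS hT cf fI.
pose f' (s : S) : range f := SigSub (mem_set (imageP f (I : [set: S] s))).
have ex (t : range f) : exists s, f s = set_val t.
  by have [s _ fs] := set_valP t; exists s.
pose g t := projT1 (cid (ex t)).
have gE t : f (g t) = set_val t by rewrite /g; case: cid.
have f'K : cancel f' g by move=> s; apply: fI; rewrite gE.
have gK : cancel g f' by move=> t; apply: val_inj; exact: gE.
have cf' : continuous f' by exact: continuous_set_type.
exists f' => //; exists g; split=> //.
apply/continuous_closedP => A cA.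
have cfA : compact (f @` A).
  apply: continuous_compact; first exact: continuous_subspaceT.
  exact: subclosed_compact cS _.
have -> : g @^-1` A = set_val @^-1` (f @` A).
  apply/seteqP; split=> [t Agt|t [s As fs]] /=.
    by exists (g t) => //; exact: gE.
  suff <- : s = g t by [].
  by apply: fI; rewrite fs gE.
apply: closed_comp; last exact: compact_closed.
by move=> t _; exact: continuous_set_val.
Qed.

(** Takes the place of a convergent subsequence, which a compact space need not provide: a cluster
    point inherits every closed inequality that a continuous function satisfies eventually along the
    sequence. *)
Lemma compact_sequence_cluster (T : topologicalType) (A : set T) (u : nat -> T) :
  compact A -> (forall n, A (u n)) ->
  exists2 x, A x & forall (h : T -> R) c N, continuous h ->
    (forall n, (N <= n)%N -> h (u n) <= c) -> h x <= c.
Proof.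
move=> cA Au.
have [|x [Ax clx]] := cA (u @ \oo) _; first by exists 0%N => // n _; exact: Au.
exists x => // h c N ch hc.
rewrite leNgt; apply/negP => cx.
have nb : nbhs x [set y | c < h y].
  apply: open_nbhs_nbhs; split=> //.
  by apply: (open_comp _ (@open_gt _ c)) => y _; exact: ch.
have [|y [[n /= Nn <-]]] := clx [set u n | n in [set n | (N <= n)%N]] _ _ nb.
  by exists N => // n /= Nn; exists n.
by rewrite /= ltNge hc.
Qed.

Lemma homeomorphic_compact (S T : topologicalType) :
  homeomorphic S T -> compact [set: T] -> compact [set: S].
Proof.
case=> f [g [fK gK cf cg]] cT.
have -> : [set: S] = range g by apply/seteqP; split=> // s _; exists (f s).
exact: compact_range.
Qed.

End real_functions.

Lemma continuous_opp {R : realType} (T : topologicalType) (f : T -> R) :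
  continuous f -> continuous (fun t => - f t).
Proof. by move=> cf t; apply: cvgN; exact: cf. Qed.

Lemma continuous_lin {R : realType} (T : topologicalType) (b c : R) (f g : T -> R) :
  continuous f -> continuous g -> continuous (fun t => b * f t + c * g t).
Proof.
move=> cf cg t; apply: cvgD; (apply: cvgM; first exact: cvg_cst).
  exact: cf.
exact: cg.
Qed.

Lemma continuous_mull {R : realType} (T : topologicalType) (c : R) (f : T -> R) :
  continuous f -> continuous (fun t => c * f t).
Proof. by move=> cf t; apply: cvgM; [exact: cvg_cst|exact: cf]. Qed.

Lemma continuous_normr {R : realType} (T : topologicalType) (f : T -> R) :
  continuous f -> continuous (fun t => `|f t|).
Proof. by move=> cf t; apply: cvg_norm; exact: cf. Qed.

(** * Eberlein and WRN compacta are QWRN *)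

Section dual_space.
Context {R : realType} {V : normedModType R}.

Lemma dual_bound (f : {ptws V -> R}) :
  dual V f -> exists n : nat, forall v, `|f v| <= n%:R * `|v|.
Proof.
case=> fl fc.
pose F : {linear V -> R} := HB.pack (f : V -> R) (GRing.isLinear.Build _ _ _ _ _ fl).
have /linear_bounded_continuous/linear_boundedP[M [_ fM]] : continuous F by [].
exists (Num.bound `|M|) => v.
by apply: fM; rewrite (le_lt_trans (ler_norm _))// archi_boundP.
Qed.

Lemma bound_dual (f : {ptws V -> R}) (C : R) :
  scalar (f : V -> R) -> (forall v, `|f v| <= C * `|v|) -> dual V f.
Proof.
move=> fl fC; split=> //.
pose F : {linear V -> R} := HB.pack (f : V -> R) (GRing.isLinear.Build _ _ _ _ _ fl).
suff : continuous F by [].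
apply/linear_bounded_continuous/linear_boundedP.
exists C; split=> [|r Cr v]; first exact: num_real.
by rewrite (le_trans (fC v))// ler_wpM2r// ltW.
Qed.

Lemma dualB (f : {ptws V -> R}) (u v : V) : dual V f -> f (u - v) = f u - f v.
Proof. by case=> fl _; rewrite addrC -scaleN1r fl mulN1r addrC. Qed.

Lemma continuous_weak (T : topologicalType) (f : T -> weak V) :
  (forall phi : dual V, continuous (fun t => set_val phi (f t) : R)) ->
  continuous f.
Proof.
by move=> fc; apply: continuous_comp_initial; apply: continuous_ptws.
Qed.

Lemma weak_continuous (phi : dual V) :
  continuous (fun v : weak V => set_val phi v : R).
Proof.
have ce := @continuous_ptws_eval (dual V) R phi.
have ci := @initial_continuous V {ptws dual V -> R}
  (fun x (f : dual V) => set_val f x).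
move=> v; exact: (continuous_comp (@ci v) (@ce _)).
Qed.

End dual_space.

Lemma continuous_bounded {R : realType} (T : topologicalType) (h : T -> R) :
  compact [set: T] -> continuous h -> exists n : nat, forall t, `|h t| <= n%:R.
Proof.
move=> cT ch; have /compact_bounded[M [_ hM]] := compact_range cT ch.
exists (Num.bound `|M|) => t; apply: hM; last by exists t.
by rewrite (le_lt_trans (ler_norm _))// archi_boundP.
Qed.

Lemma sub_independent (S : Type) (A0 A1 B0 B1 : nat -> set S) :
  (forall n, A0 n `<=` B0 n) -> (forall n, A1 n `<=` B1 n) ->
  independent A0 A1 -> independent B0 B1.
Proof.
move=> AB0 AB1 iA n eps; have [s sA] := iA n eps.
by exists s => k _; have := sA k I; case: ifP => _; [exact: AB1|exact: AB0].
Qed.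

(** Coordinates in [[0,1]] arise from the [h i] by affine rescaling. The thresholds [p < q] for a
    rescaled coordinate become thresholds for [h i] that depend on [i] only through [M i], hence not
    at all within one piece. *)
Lemma QWRN_intro {R : realType} (T : topologicalType) (Lambda : Type)
    (h : Lambda -> T -> R) (Lambda_ : nat -> set Lambda) :
  compact [set: T] -> (forall i, continuous (h i)) ->
  (forall s t, (forall i, h i s = h i t) -> s = t) ->
  \bigcup_n Lambda_ n = setT ->
  (forall n p q, p < q -> ~ contains_independent (Lambda_ n)
     (fun i => [set t | h i t < p]) (fun i => [set t | q < h i t])) ->
  QWRN R T.
Proof.
move=> cT ch hsep LT ni; split=> //.
pose M i := (projT1 (cid (continuous_bounded cT (ch i)))).+1.
have hM i t : `|h i t| <= (M i)%:R.
  rewrite /M; case: cid => n /= hn.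
  by rewrite (le_trans (hn t))// ler_nat.
have M0 i : (0 : R) < (M i)%:R by rewrite ltr0n.
(* The factor [M i] is an integer, so that the coordinates can be decomposed
   according to its value. *)
pose e (i : Lambda) (y : R) := (y / (M i)%:R + 1) / 2.
pose E (t : T) : {ptws Lambda -> R} := fun i => e i (h i t).
have eV i y : ((2 * e i y - 1) * (M i)%:R = y).
  by rewrite /e mulrC; field; rewrite gt_eqF.
have cE : continuous E.
  apply: continuous_ptws => i t; rewrite /E /e.
  apply: cvgM; last exact: cvg_cst.
  apply: cvgD; last exact: cvg_cst.
  by apply: cvgM; [exact: ch|exact: cvg_cst].
have EI : injective E.
  move=> s t Est; apply: hsep => i.
  by rewrite -(eV i (h i s)) -(eV i (h i t)) -![e _ _]/(E _ i) Est.
have hE : hausdorff_space {ptws Lambda -> R}.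
  apply: (@hausdorff_separating R) => x y xy; apply: contrapT => nh; apply: xy.
  apply/funext => i; apply: contrapT => xyi; apply: nh.
  by exists (fun f => f i) => //; exact: continuous_ptws_eval.
have [f hf fE] := homeomorphic_range cT hE cE EI.
exists Lambda, (range E), f; split=> //.
  move=> _ [t _ <-] i; rewrite /E /e.
  have := hM i t; rewrite ler_norml => /andP[h1 h2].
  have : -1 <= h i t / (M i)%:R <= 1.
    by rewrite ler_pdivlMr// ler_pdivrMr// mulN1r mul1r h1 h2.
  by move=> /andP[? ?]; apply/andP; split; lra.
move=> eps eps0.
(* The default pair yields an empty piece, because [M i] is a successor. *)
pose z (k : nat) := odflt (0, 0)%N (unpickle k).
have zE x : z (pickle x) = x by rewrite /z pickleK.
exists (fun k => Lambda_ (z k).1 `&` [set i | M i = (z k).2]).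
  apply/seteqP; split=> // i _.
  have [n _ ni'] : (\bigcup_n Lambda_ n) i by rewrite LT.
  by exists (pickle (n, M i)) => //; rewrite zE.
move=> p q pq _ k [a aL ind].
have : 0 < (z k).2%:R :> R by have [_ <-] := aL 0%N.
set m := (z k).2%:R => m0.
apply: (ni (z k).1 ((2 * p - 1) * m) ((2 * q - 1) * m)).
  by rewrite ltr_pM2r//; lra.
exists a => [n|]; first by have [] := aL n.
have eE n t : (2 * set_val (f t) (a n) - 1) * m = h (a n) t.
  rewrite fE; have -> : m = (M (a n))%:R by rewrite /m; have [_ <-] := aL n.
  exact: eV.
apply: sub_independent ind => n t /= tp.
  by rewrite -eE ltr_pM2r//; lra.
by rewrite -eE ltr_pM2r//; lra.
Qed.

Lemma compact_bounded_functions {R : realType} (I : Type) (C : I -> R) :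
  compact [set f : {ptws I -> R} | forall i, `|f i| <= C i].
Proof.
have := @tychonoff {classic I} (fun=> R) (fun i => `[- C i, C i]%classic)
  (fun i => @segment_compact R (- C i) (C i)).
congr compact; apply/seteqP.
by split=> f /= fC i; have := fC i; rewrite in_itv /= ler_norml.
Qed.

(** Independence realizes finite patterns only. A cluster point of their witnesses realizes the
    infinite pattern that is high up to [n] and low afterwards, at the price of weak
    inequalities. *)
Lemma independent_split {R : realType} (T : topologicalType) (g : nat -> T -> R)
    (p q : R) :
  compact [set: T] -> (forall k, continuous (g k)) ->
  independent (fun k => [set t | g k t < p]) (fun k => [set t | q < g k t]) ->
  forall n, exists t, (forall k, (k <= n)%N -> q <= g k t) /\
                      (forall k, (n < k)%N -> g k t <= p).
Proof.
move=> cT cg ind n.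
have /choice[u uP] : forall N : nat, exists t, forall k, (k <= N)%N ->
    if (k <= n)%N then q < g k t else g k t < p.
  move=> N; have [t tP] := ind N (fun k => (k <= n)%N).
  by exists t => k kN; have := tP (Ordinal (kN : (k < N.+1)%N)) I; case: ifP.
have [t _ tP] := @compact_sequence_cluster R T setT u cT (fun=> I).
exists t; split=> k kn.
  rewrite -lerN2; apply: (tP (fun t => - g k t) _ k) => [s|N kN].
    by apply: cvgN; exact: cg.
  by rewrite lerN2 ltW//; have := uP N k kN; rewrite kn.
apply: (tP (g k) _ k) => // N kN; rewrite ltW//.
by have := uP N k kN; rewrite leqNgt kn.
Qed.

(** A weak-star cluster point, obtained from Tychonoff's theorem. Linearity and the norm bound are
    closed conditions in the product, so the cluster point is again a functional. *)
Lemma cluster_dual {R : realType} (V : normedModType R) (a : nat -> dual V) (C : R) :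
  (forall k v, `|set_val (a k) v| <= C * `|v|) ->
  exists phi : dual V, forall c v N,
    ((forall k, (N <= k)%N -> set_val (a k) v <= c) -> set_val phi v <= c) /\
    ((forall k, (N <= k)%N -> c <= set_val (a k) v) -> c <= set_val phi v).
Proof.
move=> aC.
have [f fC fP] := @compact_sequence_cluster R _ _ (fun k => set_val (a k))
  (@compact_bounded_functions R V (fun v : V => C * `|v|)) aC.
have ev v : continuous (fun f : {ptws V -> R} => f v : R).
  exact: (@continuous_ptws_eval V R).
have f0 (h : {ptws V -> R} -> R) :
    continuous h -> (forall k, h (set_val (a k)) = 0) -> h f = 0.
  move=> ch h0; apply/eqP; rewrite eq_le -oppr_le0.
  apply/andP; split; first by apply: (fP _ _ 0%N) => // k _; rewrite h0.
  by apply: (fP _ _ 0%N (continuous_opp ch)) => k _; rewrite h0 oppr0.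
have fl : scalar (f : V -> R).
  move=> b u v; apply/eqP; rewrite -subr_eq0; apply/eqP.
  have := f0 (fun f => 1 * f (b *: u + v) + (-1) * (b * f u + 1 * f v)).
  rewrite !mul1r mulN1r; apply=> [|k].
    exact: (continuous_lin (ev _) (continuous_lin (ev u) (ev v))).
  have -> : set_val (a k) (b *: u + v) = b * set_val (a k) u + set_val (a k) v.
    by have [al _] := set_valP (a k); exact: al.
  ring.
exists (SigSub (mem_set (bound_dual fl fC))) => c v N; split=> ac.
  by apply: (fP (fun f => f v) c N) => //; exact: ev.
rewrite -lerN2; apply: (fP (fun f => - f v) (- c) N) => [g|k Nk].
  exact: (continuous_opp (ev v)).
by rewrite lerN2 ac.
Qed.

(** The pieces are the balls of the dual. Given an independent sequence [a] in a ball, let [x n] be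
    a point where [a k] is at least [q] for [k <= n] and at most [p] for [k > n]. Let [phi] be a
    cluster point of [a] and [y] one of [x]. Then [phi] is at most [p] at each [x m], hence at [y];
    but each [a k] is at least [q] at [y], hence so is [phi]. *)
Lemma Eberlein_QWRN {R : realType} (T : topologicalType) :
  hausdorff_space T -> Eberlein R T -> QWRN R T.
Proof.
move=> hT [V [L [cL TL]]].
have cT := homeomorphic_compact TL (compact_setT_set_type cL).
case: TL => F [G [FK GK cF cG]].
pose h (phi : dual V) t : R := set_val phi (set_val (F t) : V).
have ch phi : continuous (h phi).
  have c1 : continuous (fun t => set_val (F t)).
    by move=> t; exact: (continuous_comp (cF t) (@continuous_set_val _ L _)).
  move=> t; exact: (continuous_comp (c1 t) (@weak_continuous R V phi _)).
apply: (@QWRN_intro R T (dual V) h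
  (fun n => [set phi | forall v, `|set_val phi v| <= n%:R * `|v|])) => //.
(* Points on which all functionals agree have images in the same weakly open sets, so the Hausdorff
   property of [T] identifies them. *)
- move=> s t hst; apply: hT => A B As Bt.
  suff Bs : B s by exists s; split=> //; exact: nbhs_singleton.
  have : nbhs (F t) (G @^-1` B) by apply: cG; rewrite FK.
  case=> _ [[_ [U oU <-] <-]] /= Ot OB.
  rewrite -(FK s); apply: OB => /=; congr U: Ot.
  by apply/funext => phi; exact: (esym (hst phi)).
- apply/seteqP; split=> // phi _.
  by have [n nP] := dual_bound (set_valP phi); exists n.
move=> n p q pq [a an ind].
have [phi phiP] := cluster_dual an.
have /choice[x xP] := independent_split cT (fun k => ch (a k)) ind.
have [y _ yP] := @compact_sequence_cluster R T setT x cT (fun=> I).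
have : h phi y <= p.
  apply: (yP _ _ 0%N) => // m _.
  by have [+ _] := phiP p (set_val (F (x m))) m.+1; apply=> k mk; apply (xP m).2.
have : q <= h phi y.
  have [_ +] := phiP q (set_val (F y)) 0%N; apply=> k _.
  rewrite -lerN2; apply: (yP (fun t => - h (a k) t) _ k) => [t|m km].
    by apply: cvgN; exact: ch.
  by rewrite lerN2; apply (xP m).1.
by lra.
Qed.

Lemma scalar_sum {R : realType} (V : lmodType R) (f : V -> R) (u : nat -> R)
    (v : nat -> V) N : scalar f ->
  f (\sum_(0 <= k < N) u k *: v k) = \sum_(0 <= k < N) u k * f (v k).
Proof.
move=> fl; have f0 : f 0 = 0.
  by have := fl 1 0 0; rewrite scale1r addr0 mul1r => /eqP; rewrite -subr_eq subrr => /eqP.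
elim: N => [|N IHN]; first by rewrite !big_geq.
by rewrite !big_nat_recr//= addrC fl IHN addrC.
Qed.

Section independent_ell1.
Context {R : realType} (V : completeNormedModType R).
Variables (v : nat -> V) (C : R).
Hypothesis vC : forall k, `|v k| <= C.

Let C0 : 0 <= C. Proof. exact: le_trans (vC 0%N). Qed.

Lemma ell1_series_scale_cvg (u : nat -> R) :
  ell1 R u -> cvgn (series (fun k => u k *: v k)).
Proof.
move=> u1; apply: normed_cvg.
apply: (@series_le_cvg R _ (fun k => C * `|u k|)) => [k|k|k|].
- exact: normr_ge0.
- exact: mulr_ge0.
- by rewrite /= normrZ mulrC ler_wpM2r.
rewrite (_ : series _ = (fun n => C * [normed series u] n)).
  by apply: is_cvgM => //; exact: is_cvg_cst.
by apply/funext => n; rewrite /series/= mulr_sumr.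
Qed.

Lemma lower_ell1_contains (c : R) : 0 < c ->
  (forall (u : nat -> R) N, c * \sum_(0 <= k < N) `|u k| <=
     `|\sum_(0 <= k < N) u k *: v k|) ->
  contains_ell1 V.
Proof.
move=> c0 low.
exists (fun u => limn (series (fun k => u k *: v k))).
  move=> a u w u1 w1.
  rewrite (_ : series _ = (fun n => a *: series (fun k => u k *: v k) n +
      series (fun k => w k *: v k) n)); last first.
    apply/funext => n; rewrite /series/= scaler_sumr -big_split/=.
    by apply: eq_bigr => k _; rewrite scalerDl scalerA.
  have cu := ell1_series_scale_cvg u1; have cw := ell1_series_scale_cvg w1.
  apply/cvg_lim => //; apply: cvgD => //.
  by apply: cvgZ; [exact: cvg_cst|exact: cu].
exists c, C; split=> // u u1; have cu := ell1_series_scale_cvg u1.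
have cn : limn (fun n => `|series (fun k => u k *: v k) n|) =
    `|limn (series (fun k => u k *: v k))|.
  by apply/cvg_lim => //; exact: cvg_norm.
have is_cn : cvgn (fun n => `|series (fun k => u k *: v k) n|).
  exact: (is_cvg_norm cu).
have lc (b : R) : limn (fun n => b * [normed series u] n) = b * ell1_norm u.
  by apply/cvg_lim => //; apply: cvgM => //; exact: cvg_cst.
have is_lc (b : R) : cvgn (fun n => b * [normed series u] n).
  by apply: is_cvgM => //; exact: is_cvg_cst.
rewrite -cn -!lc; apply/andP; split; apply: ler_lim => //.
  by apply: nearW => n; exact: low.
apply: nearW => n; rewrite mulr_sumr (le_trans (ler_norm_sum _ _ _))//.
by apply: ler_sum => k _; rewrite normrZ mulrC ler_wpM2r.
Qed.

(** Rosenthal's argument: independence gives a point [s] that follows the signs of the coefficients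
    and a point [t] that follows the opposite signs. On the combination [w], [Phi s] and [Phi t]
    then differ by at least [q - p] times the sum of the absolute values of the coefficients, and by
    at most [2 * |M| * |w|]. *)
Lemma independent_contains_ell1 (S : Type) (Phi : S -> V -> R) (M p q : R) :
  (forall s, scalar (Phi s)) -> (forall s w, `|Phi s w| <= M * `|w|) -> p < q ->
  independent (fun k => [set s | Phi s (v k) < p])
              (fun k => [set s | q < Phi s (v k)]) ->
  contains_ell1 V.
Proof.
move=> Pl PM pq ind.
have M0 : 0 <= `|M| by [].
(* The [+ 1] keeps the denominator positive even if [M] is 0. *)
apply: (@lower_ell1_contains ((q - p) / (2 * `|M| + 1))).
  by rewrite divr_gt0; lra.
move=> u N; set w := \sum_(_ <= k < _) u k *: _.
rewrite mulrAC ler_pdivrMr; last lra.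
have [s sP] := ind N (fun k => 0 <= u k).
have [t tP] := ind N (fun k => u k < 0).
have le1 : (q - p) * \sum_(0 <= k < N) `|u k| <= Phi s w - Phi t w.
  rewrite /w (scalar_sum u v N (Pl s)) (scalar_sum u v N (Pl t)).
  rewrite -sumrB mulr_sumr !big_nat; apply: ler_sum => k /andP[_ kN].
  have kN' : (k < N.+1)%N by exact: ltnW.
  have := sP (Ordinal kN') I; have := tP (Ordinal kN') I => /=.
  case: (leP 0 (u k)) => uk /= h1 h2.
    by rewrite ger0_norm// mulrC -mulrBr ler_wpM2l//; lra.
  by rewrite ltr0_norm// -mulrBr -[leRHS]mulrNN mulrC ler_wpM2l//; lra.
have := PM s w; have := PM t w; rewrite !ler_norml => /andP[h1 _] /andP[_ h2].
have h3 : M * `|w| <= `|M| * `|w| by rewrite ler_wpM2r// ler_norm.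
have := normr_ge0 w; nra.
Qed.

End independent_ell1.

(** The pieces are the balls of [V]. The compact set of functionals is pointwise bounded, so
    Banach-Steinhaus supplies the uniform bound [M] under which an independent sequence of vectors
    generates ell1. *)
Lemma WRN_QWRN {R : realType} (T : topologicalType) : WRN R T -> QWRN R T.
Proof.
case=> V [nV [L [cL TL]]].
have cT := homeomorphic_compact TL (compact_setT_set_type cL).
case: TL => F [G [FK GK cF cG]].
pose h v t : R := set_val (set_val (F t)) v.
have Fd t : dual V (set_val (set_val (F t))) by exact: set_valP.
have ch v : continuous (h v).
  have c1 : continuous (fun t => set_val (F t)).
    by move=> t; exact: (continuous_comp (cF t) (@continuous_set_val _ L _)).
  have c2 : continuous (fun t => set_val (set_val (F t))).
    by move=> t; exact: (continuous_comp (c1 t) (@continuous_set_val _ (dual V) _)).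
  move=> t; exact: (continuous_comp (c2 t) (@continuous_ptws_eval _ _ v _)).
have [M hM] : exists M : R, forall t v, `|v| <= 1 -> `|h v t| <= M.
  have [|w|M HM] := @Banach_Steinhauss R V R [set f | exists t, f = h ^~ t] _ _ 1.
  - move=> _ [t ->]; split; last by have [] := Fd t.
    move=> r; have [n nP] := dual_bound (Fd t).
    exists (n%:R * r) => v vr; rewrite (le_trans (nP v))//.
    by rewrite ler_wpM2l.
  - have [n nP] := continuous_bounded cT (ch w).
    by exists n%:R => _ [t ->].
  by exists M => t v v1; apply: (HM (h ^~ t)) => //; exists t.
apply: (@QWRN_intro R T V h (fun n => [set v | `|v| <= n%:R])) => //.
- move=> s t hst; apply: (can_inj FK); do 2 apply: val_inj.
  by apply/funext => v; exact: hst.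
- apply/seteqP; split=> // v _; exists (Num.bound `|v|) => //=.
  by rewrite ltW// archi_boundP.
move=> n p q pq [a an ind]; apply: nV.
apply: (independent_contains_ell1 (C := n%:R) an (M := M)
  (Phi := fun t v => h v t) _ _ pq ind).
  by move=> t; have [] := Fd t.
move=> t w; have [->|w0] := eqVneq w 0.
  by have [n' /(_ 0)] := dual_bound (Fd t); rewrite normr0 !mulr0.
have [fl _] := Fd t.
have /(hM t) : `| `|w|^-1 *: w | <= 1 by rewrite normfZV.
have -> : h (`|w|^-1 *: w) t = `|w|^-1 * h w t.
  have f0 := @scalar_sum R V (h ^~ t) (fun=> `|w|^-1) (fun=> w) 1 fl.
  by move: f0; rewrite !big_nat1.
by rewrite normrM normfV normr_id mulrC ler_pdivrMr// normr_gt0.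
Qed.

(** * Countable separation in solid QWRN compacta *)

Section set_mapping.
Context {T : Type} (F : T -> set T).
Hypothesis finF : forall x, finite_set (F x).

Let reach (x : T) (n : nat) : set T :=
  iter n (fun A => \bigcup_(y in A) F y) [set x].

Let countable_reach x : countable (\bigcup_n reach x n).
Proof.
apply: bigcup_countable => // n _; apply: finite_set_countable.
elim: n => [|n IHn]; first exact: finite_set1.
exact: bigcup_finite.
Qed.

Let partial_coloring (Z : set (T * nat)) :=
  [/\ forall x m n, Z (x, m) -> Z (x, n) -> m = n,
      forall x m y, Z (x, m) -> F x y -> exists n, Z (y, n) &
      forall x m y n, Z (x, m) -> Z (y, n) -> F x y -> x <> y -> m <> n].

(* A maximal coloring of an [F]-closed set is total: the [F]-closure of a new
   point only adds countably many points, and no point already colored has a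
   new point among its [F]-successors.  The colors of the new points are picked
   in pairwise disjoint infinite sets, avoiding those of their successors. *)
Lemma set_mapping_coloring :
  exists c : T -> nat, forall x y, F x y -> x <> y -> c x <> c y.
Proof.
have [|Z [[Zfun ZF Zcol] Zmax]] := @Zorn_bigcup _ partial_coloring.
  move=> C CP Ctot; have join A B z w : C A -> C B -> A z -> B w ->
      exists D, [/\ C D, D z & D w].
    move=> CA CB Az Bw.
    by have [AB|BA] := Ctot A B CA CB; [exists B|exists A]; split=> //; auto.
  split.
  - move=> x m n [A CA Am] [B CB Bn].
    have [D [CD Dm Dn]] := join _ _ _ _ CA CB Am Bn.
    by have [+ _ _] := CP D CD; apply; eauto.
  - move=> x m y [A CA Am] Fxy; have [_ + _] := CP A CA.
    by move=> /(_ _ _ _ Am Fxy)[n An]; exists n; exists A.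
  - move=> x m y n [A CA Am] [B CB Bn].
    have [D [CD Dm Dn]] := join _ _ _ _ CA CB Am Bn.
    by have [_ _ +] := CP D CD; apply.
suff allx x0 : exists n, Z (x0, n).
  have [c cZ] := choice allx.
  by exists c => x y; exact: Zcol (cZ x) (cZ y).
apply: contrapT => nx0.
pose E := [set y | (\bigcup_n reach x0 n) y /\ ~ exists n, Z (y, n)].
have [e eI] : exists e : T -> nat, {in \bigcup_n reach x0 n &, injective e}.
  by have /countable_injP[e eI] := countable_reach x0; exists e.
have Eclosed y z : E y -> F y z -> (exists n, Z (z, n)) \/ E z.
  move=> [[n _ yn] _] Fyz; have [zZ|nz] := pselect (exists n, Z (z, n)).
    by left.
  by right; split=> //; exists n.+1 => //; exists y.
(* The colors reserved for [y] are the [pickle (e y, k)]. Each colored successor of [y] excludes at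
   most one [k], and there are finitely many successors. *)
have allk' y : exists k : nat, forall z n, F y z -> Z (z, n) -> n <> pickle (e y, k).
  apply: contrapT => nk.
  have allk (k : nat) : exists zn : T * nat, [/\ F y zn.1, Z zn & zn.2 = pickle (e y, k)].
    apply: contrapT => nzn; apply: nk; exists k => z n Fz Zn nE.
    by apply: nzn; exists (z, n).
  have [z zP] := choice allk.
  have zI : injective (fst \o z).
    move=> k k' /= zz; have [_ Zk Ek] := zP k; have [_ Zk' Ek'] := zP k'.
    move: Zk Zk' Ek Ek' zz; case: (z k) => a i; case: (z k') => b j /=.
    move=> Zk Zk' Ek Ek' ab; rewrite ab in Zk.
    have : pickle (e y, k) = pickle (e y, k') by rewrite -Ek -Ek'; exact: Zfun Zk Zk'.
    by move=> /(pcan_inj pickleK)[].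
  have : finite_set [set: nat].
    apply: (@sub_finite_set _ _ ((fst \o z) @^-1` F y)).
      by move=> n _; have [] := zP n.
    by apply: finite_preimage => // m n _ _; exact: zI.
  exact: infinite_nat.
have [k kP] := choice allk'.
pose Z' := Z `|` [set yn | E yn.1 /\ yn.2 = pickle (e yn.1, k yn.1)].
apply: (Zmax Z').
  split; first by move=> z Zz; left.
  move=> /(_ (x0, pickle (e x0, k x0)))Z'Z; apply: (nx0).
  exists (pickle (e x0, k x0)); apply: Z'Z; right; split=> //.
  by split=> //; exists 0%N.
split.
- move=> x m n [Zm|[Em /= mE]] [Zn|[En /= nE]].
  + exact: Zfun Zm Zn.
  + by have [_ []] := En; exists m.
  + by have [_ []] := Em; exists n.
  + by rewrite mE nE.
- move=> x m y [Zm|[Em /= mE]] Fxy.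
    by have [n Zn] := ZF _ _ _ Zm Fxy; exists n; left.
  have [[n Zn]|Ey] := Eclosed _ _ Em Fxy; first by exists n; left.
  by exists (pickle (e y, k y)); right.
- move=> x m y n [Zm|[Em /= mE]] [Zn|[En /= nE]] Fxy xy.
  + exact: Zcol Zm Zn Fxy xy.
  + by have [_ []] := En; exact: ZF Zm Fxy.
  + by move=> mn; apply: (kP x y n Fxy Zn); rewrite -mn.
  + rewrite mE nE => /(pcan_inj pickleK)[exy _]; apply: xy.
    by apply: eI exy; rewrite inE; [have [] := Em|have [] := En].
Qed.

End set_mapping.

(** The sets containing such a box form a filter, and its convergence to [x] can be tested one
    coordinate at a time. *)
Lemma nbhs_ptws {R : realType} (I : Type) (x : {ptws I -> R}) (U : set {ptws I -> R}) :
  nbhs x U -> exists (F : set I) (eta : R), [/\ finite_set F, 0 < eta &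
    forall y, (forall i, F i -> `|y i - x i| < eta) -> U y].
Proof.
pose B : set_system {ptws I -> R} := [set U | exists (F : set I) (eta : R),
  [/\ finite_set F, 0 < eta & forall y, (forall i, F i -> `|y i - x i| < eta) -> U y]].
have FB : Filter B.
  split=> [|P Q [F [a [fF a0 FP]]] [G [b [fG b0 GQ]]]|P Q PQ [F [a [fF a0 FP]]]].
  - by exists set0, 1; split.
  - exists (F `|` G), (Num.min a b); split.
    + by rewrite finite_setU.
    + by rewrite lt_min a0.
    move=> y yP; split.
      by apply: FP => i Fi; have := yP i (or_introl Fi); rewrite lt_min => /andP[].
    by apply: GQ => i Gi; have := yP i (or_intror Gi); rewrite lt_min => /andP[].
  - by exists F, a; split=> // y /FP/PQ.
suff : B --> x by apply.
apply/cvg_sup => i A [_ [[W oW <-] /= Oxi OA]].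
have /nbhs_ballP[e /= e0 eO] : nbhs (x i) W by exact: open_nbhs_nbhs.
exists [set i], e; split=> // y yi; apply: OA; apply: eO.
by rewrite /ball/= distrC; exact: yi.
Qed.

Lemma independentC (S : Type) (A0 A1 : nat -> set S) :
  independent A0 A1 -> independent A1 A0.
Proof.
move=> ind n eps; have [s sA] := ind n (fun k => ~~ eps k).
by exists s => k _; have := sA k I; case: (eps k).
Qed.

Lemma infinite_sequence (T : Type) (A : set T) :
  infinite_set A -> exists2 a : nat -> T, injective a & forall n, A (a n).
Proof.
move=> /infiniteP/card_leP[f].
pose e n : [set: nat] := SigSub (mem_set (I : [set: nat] n)).
exists (fun n => set_val (f (e n))) => [m n /val_inj mn|n]; last exact: set_valP.
have /(congr1 set_val) // : e m = e n by apply: (@inj _ _ _ f) mn; rewrite inE.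
Qed.

Section solid.
Context {R : realType} {Gamma : Type} (K : set {ptws Gamma -> R}).
Hypothesis K_solid : solid K.

(* On the points of [K] vanishing on the finite set [F], the coordinate function
   [h i] detects whether the coordinate [g] is null or within [r] of [c]. *)
Definition switches (Lambda : Type) (h : Lambda -> K -> R) (J : set Lambda)
    (p q c r : R) (g : Gamma) (i : Lambda) (F : set Gamma) : Prop :=
  [/\ J i, finite_set F, ~ F g,
      forall y : K, (forall e, F e -> set_val y e = 0) ->
        set_val y g = 0 -> h i y < p &
      forall y : K, (forall e, F e -> set_val y e = 0) ->
        `|set_val y g - c| <= r -> q < h i y].

(** Two indices of one color never lie in each other's finite sets. If [x] had infinitely many of
    these coordinates in one color, restricting [x] to a finite set of them would switch on exactly
    the corresponding functions, so all finite patterns would occur. *)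
Lemma no_independent_coloring (Lambda : Type) (h : Lambda -> K -> R)
    (J : set Lambda) (p q c r : R) :
  ~ contains_independent J (fun i => [set y | h i y < p])
      (fun i => [set y | q < h i y]) ->
  exists col : Gamma -> nat, forall k x, K x -> finite_set [set g |
    [/\ exists i F, switches h J p q c r g i F,
        col g = k & `|x g - c| <= r]].
Proof.
move=> nind; pose P := switches h J p q c r.
(* The set mapping must be total to be colored; it is empty where nothing switches. *)
have allF g : exists F, finite_set F /\ ((exists i F, P g i F) -> exists i, P g i F).
  have [[i [F PF]]|nP] := pselect (exists i F, P g i F).
    by exists F; split=> [|_]; [have [] := PF|exists i].
  by exists set0; split.
have [F FP] := choice allF.
have [col colP] := set_mapping_coloring (fun g => (FP g).1).
exists col => k x Kx; apply: contrapT => /infinite_sequence[a aI aA].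
have alli n : exists i, P (a n) i (F (a n)).
  by have [+ _ _] := aA n; exact: (FP (a n)).2.
have [i iP] := choice alli.
apply: nind; exists i => [n|n eps]; first by have [] := iP n.
(* [x] is cut down to those coordinates among [a 0], ..., [a n] where [eps] asks for the upper
   set. *)
pose B := [set a j | j in [set j : nat | exists2 k : 'I_n.+1, eps k & j = k :> nat]].
have Ka : K (patch (fun=> 0) B x).
  apply: K_solid => //; apply: finite_image.
  apply: (@sub_finite_set _ _ `I_n.+1); last exact: finite_II.
  by move=> _ [j _ ->] /=.
pose y : K := SigSub (mem_set Ka).
have yE e : set_val y e = patch (fun=> 0) B x e by [].
exists y => j _.
have Baj : B (a j) <-> eps j.
  split=> [[_ [l el ->] /aI/val_inj <-] //|ej].
  by exists j => //; exists j.
(* The elements of [B] have the color of [a j], so only [a j] itself could belong to [F (a j)], and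
   it does not. *)
have F0 e : F (a j) e -> patch (fun=> 0) B x e = 0.
  move=> Fe; rewrite patchE; case: ifPn => //; rewrite inE => -[l _ le].
  have [_ _ nF _ _] := iP j; have [_ cl _] := aA l; have [_ cj _] := aA j.
  exfalso; apply: (colP (a j) e) => //; last by rewrite -le cl cj.
  by move=> aje; apply: nF; rewrite {2}aje.
have [_ _ _ Pp Pq] := iP j; have [_ _ xaj] := aA j.
case: ifPn => ej /=.
  apply: Pq => [e Fe|]; first by rewrite yE F0.
  by rewrite yE patchE ifT// inE; exact/Baj.
apply: Pp => [e Fe|]; first by rewrite yE F0.
by rewrite yE patchE ifF//; apply/negP; rewrite inE => /Baj; exact/negP.
Qed.

(* The condition [r i < |c i|] makes the bump of radius [r i] around [c i]
   vanish at [0]. *)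
Definition bump_system (I : Type) (Gam : I -> set Gamma) (c r : I -> R) :=
  [/\ forall i g, Gam i g -> 0 < r i <= 1 /\ r i < `|c i|,
      forall i x, K x -> finite_set [set g | Gam i g /\ `|x g - c i| <= r i] &
      forall x g delta, K x -> x g != 0 -> 0 < delta ->
        exists i, [/\ Gam i g, `|x g - c i| < r i & r i < delta]].

(** A family of bumps is indexed by rational [c], [r], [p], [q], a lower bound [1 / m.+1] for the
    gap, the piece [n] of the decomposition, a sign and a color: countably many data, each giving a
    point-finite family. *)
Lemma QWRN_bump_system : QWRN R K ->
  exists (I : countType) (Gam : I -> set Gamma) (c r : I -> R), bump_system Gam c r.
Proof.
move=> [_ [Lambda [L [f [_ [f' [fK _ cf _]] ind]]]]].
(* With the sign, a coordinate function that distinguishes two points can be assumed to increase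
   from the first to the second. *)
pose h (b : bool) i (y : K) : R := (-1) ^+ b * set_val (f y) i.
have ch b i : continuous (h b i).
  have c1 : continuous (fun y => set_val (f y)).
    by move=> y; exact: (continuous_comp (cf y) (@continuous_set_val _ L _)).
  have c2 : continuous (fun y => set_val (f y) i).
    by move=> y; exact: (continuous_comp (c1 y) (@continuous_ptws_eval _ _ i _)).
  exact: (continuous_mull c2).
have [Lam LamP] : exists Lam : nat -> nat -> set Lambda, forall m,
    \bigcup_n Lam m n = setT /\ forall b (p q : R) n, p < q -> m.+1%:R^-1 < q - p ->
    ~ contains_independent (Lam m n) (fun i => [set y | h b i y < p])
        (fun i => [set y | q < h b i y]).
  suff all m : exists Lam : nat -> set Lambda,
      \bigcup_n Lam n = setT /\ forall b (p q : R) n, p < q -> m.+1%:R^-1 < q - p ->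
      ~ contains_independent (Lam n) (fun i => [set y | h b i y < p])
          (fun i => [set y | q < h b i y]).
    by have [Lam LamP] := choice all; exists Lam.
  have [|Lam LamT LamP] := ind m.+1%:R^-1; first by rewrite invr_gt0 ltr0n.
  exists Lam; split=> // -[] p q n pq mpq [a aL inda].
    apply: (LamP (- q) (- p) _ _ n); [by rewrite ltrN2|by rewrite opprK addrC|].
    exists a => //; apply: independentC.
    apply: sub_independent inda => k y /=; rewrite /h expr1 mulN1r; lra.
  apply: (LamP p q pq mpq n); exists a => //.
  by apply: sub_independent inda => k y /=; rewrite /h expr0 mul1r.
pose D : countType := ((rat * rat) * (rat * rat) * (nat * nat) * bool)%type.
pose cc (d : D) : R := ratr d.1.1.1.1.
pose rr (d : D) : R := ratr d.1.1.1.2.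
pose pp (d : D) : R := ratr d.1.1.2.1.
pose qq (d : D) : R := ratr d.1.1.2.2.
pose good (d : D) := [/\ pp d < qq d, d.1.2.1.+1%:R^-1 < qq d - pp d, 0 < rr d <= 1
  & rr d < `|cc d|].
have allcol (d : D) : exists col : Gamma -> nat, good d -> forall k x, K x -> finite_set
    [set g | [/\ exists i F, switches (h d.2) (Lam d.1.2.1 d.1.2.2)
                   (pp d) (qq d) (cc d) (rr d) g i F,
        col g = k & `|x g - cc d| <= rr d]].
  have [[pq mpq _ _]|ng] := pselect (good d); last by exists (fun=> 0%N).
  have [_ /(_ d.2 _ _ d.1.2.2 pq mpq)] := LamP d.1.2.1.
  by move=> /(@no_independent_coloring _ _ _ _ _ (cc d) (rr d))[col colP]; exists col.
have [col colP] := choice allcol.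
exists (D * nat)%type, (fun dk => [set g | [/\ good dk.1,
  exists i F, switches (h dk.1.2) (Lam dk.1.1.2.1 dk.1.1.2.2)
    (pp dk.1) (qq dk.1) (cc dk.1) (rr dk.1) g i F &
  col dk.1 g = dk.2]]), (fun dk => cc dk.1), (fun dk => rr dk.1).
split.
- by move=> [d k] g /= [[]].
- move=> [d k] x Kx /=.
  have [gd|ng] := pselect (good d); last first.
    by apply: (@sub_finite_set _ _ set0) => // g [[]].
  apply: sub_finite_set (colP d gd k x Kx) => g [[_ gP cg] xg].
  by split.
move=> x g delta Kx xg0 delta0.
(* By solidity [K] contains the zero function and the point with the single coordinate [x g]; some
   coordinate function separates them. *)
pose z0 : {ptws Gamma -> R} := patch (fun=> 0) set0 x.
pose z1 : {ptws Gamma -> R} := patch (fun=> 0) [set g] x.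
have K0 : K z0 by exact: K_solid.
have K1 : K z1 by apply: K_solid => //; exact: finite_set1.
pose y0 : K := SigSub (mem_set K0); pose y1 : K := SigSub (mem_set K1).
have z0E e : z0 e = 0 by rewrite /z0 patchE ifF//; apply/negP; rewrite inE.
have z1E e : e <> g -> z1 e = 0.
  by move=> eg; rewrite /z1 patchE ifF//; apply/negP; rewrite inE.
have z1g : z1 g = x g by rewrite /z1 patchE ifT// inE.
have [b [i hb]] : exists b i, h b i y0 < h b i y1.
  apply: contrapT => nb.
  have : y0 = y1.
    apply: (can_inj fK); apply: val_inj; apply/funext => i; apply: contrapT => fi.
    apply: nb; have [l|l|//] := ltgtP (set_val (f y0) i) (set_val (f y1) i).
      by exists false, i; rewrite /h expr0 !mul1r.
    by exists true, i; rewrite /h expr1 !mulN1r ltrN2.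
  move=> /(congr1 (fun y : K => set_val y g)) /= z01.
  by move/eqP: xg0; apply; rewrite -z1g; exact: (etrans (esym z01) (z0E g)).
have [p] := @rat_in_itvoo R (h b i y0) ((h b i y0 + h b i y1) / 2) ltac:(lra).
have [q] := @rat_in_itvoo R ((h b i y0 + h b i y1) / 2) (h b i y1) ltac:(lra).
rewrite !in_itv /= => /andP[hq hq1] /andP[hp0 hp].
have pq : ratr p < ratr q :> R by lra.
have [m mpq] : exists m : nat, m.+1%:R^-1 < ratr q - ratr p :> R.
  exists (Num.bound (ratr q - ratr p : R)^-1).
  rewrite invf_plt ?posrE//; last lra.
  apply: lt_trans (archi_boundP _) _; first by rewrite invr_ge0; lra.
  by rewrite ltr_nat.
have [n Lamn] : exists n, Lam m n i.
  by have [+ _] := LamP m => /seteqP[_ /(_ i I)][n _]; exists n.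
have basis (y : K) (U : set R) : nbhs (h b i y) U -> exists (F : set Gamma) (eta : R),
    [/\ finite_set F, 0 < eta & forall y' : K,
    (forall e, F e -> `|set_val y' e - set_val y e| < eta) -> U (h b i y')].
  move=> /ch [_ [[V oV <-] /= Vy VU]].
  have /nbhs_ptws[F [eta [fF eta0 FV]]] : nbhs (set_val y : {ptws Gamma -> R}) V.
    exact: open_nbhs_nbhs.
  by exists F, eta; split=> // y' /FV Vy'; exact: VU.
have [F0 [eta0 [fF0 eta00 F0P]]] := basis y0 _ (lt_nbhsl hp0).
have [F1 [eta1 [fF1 eta10 F1P]]] := basis y1 _ (lt_nbhsr hq1).
(* With [c] within [r] of [x g], the bound [eta1 / 2] puts all values within [r] of [c] within
   [eta1] of [x g], and [|x g| / 2] ensures [r < |c|]. *)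
pose rho := Num.min (Num.min delta (eta1 / 2)) (Num.min (`|x g| / 2) 1).
have nxg : 0 < `|x g| by rewrite normr_gt0.
have rho0 : 0 < rho by rewrite !lt_min; do !(apply/andP; split); lra.
have [r] := @rat_in_itvoo R 0 rho rho0; rewrite in_itv/= => /andP[r0].
rewrite !lt_min => /andP[/andP[rdelta reta] /andP[rx r1]].
have [c] := @rat_in_itvoo R (x g - ratr r) (x g + ratr r) ltac:(lra).
rewrite in_itv/= => /andP[xc cx].
have xcr : `|x g - ratr c| < ratr r by rewrite ltr_norml; apply/andP; split; lra.
exists ((c, r, (p, q), (m, n), b), col (c, r, (p, q), (m, n), b) g).
split=> //; split=> //=.
  split=> //; first by rewrite /rr/= r0 ltW.
  have := ler_normD (x g - ratr c) (ratr c); rewrite subrK /rr /cc/=; lra.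
exists i, ((F0 `|` F1) `\` [set g]); split=> //.
- by apply: finite_setD; rewrite finite_setU.
- by case=> _; apply.
- move=> y yF yg; apply: F0P => e Fe; rewrite -[set_val y0 e]/(z0 e) z0E subr0.
  suff -> : set_val y e = 0 by rewrite normr0.
  have [->//|eg] := pselect (e = g).
  by apply: yF; split=> //; left.
- move=> y yF yg; apply: F1P => e Fe; rewrite -[set_val y1 e]/(z1 e).
  have [->|eg] := pselect (e = g).
    rewrite z1g; have := ler_distD (ratr c) (set_val y g) (x g).
    by move: yg; rewrite /cc /rr/= (distrC (ratr c)); lra.
  by rewrite z1E// yF ?subrr ?normr0//; split=> //; right.
Qed.

Lemma QWRN_bump_system_nat : QWRN R K ->
  exists (Gam : nat -> set Gamma) (c r : nat -> R), bump_system Gam c r.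
Proof.
move=> /QWRN_bump_system[I [Gam [c [r [cr fin sep]]]]].
exists (fun n => oapp Gam set0 (unpickle n)), (fun n => oapp c 0 (unpickle n)),
  (fun n => oapp r 0 (unpickle n)); split.
- by move=> n g; case: unpickle => [i|//]; exact: cr.
- move=> n x Kx; case: unpickle => [i|]; first exact: fin.
  by apply: (@sub_finite_set _ _ set0) => // g [].
- move=> x g delta Kx xg delta0; have [i iP] := sep _ _ _ Kx xg delta0.
  by exists (pickle i); rewrite pickleK.
Qed.

End solid.

(** * Bump functions of the coordinates *)

Section bump.
Context {R : realType} {Gamma : Type}.
Variables (Gam : nat -> set Gamma) (c r : nat -> R).

Definition bump (i : nat) (g : Gamma) (x : {ptws Gamma -> R}) : R :=
  if g \in Gam i then Num.max (r i - `|x g - c i|) 0 else 0.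

Lemma bump_ge0 i g x : 0 <= bump i g x.
Proof. by rewrite /bump; case: ifP => //; rewrite le_max lexx orbT. Qed.

Lemma bump_neq0 i g x : bump i g x != 0 -> Gam i g /\ `|x g - c i| < r i.
Proof.
rewrite /bump; case: ifPn => [|_]; last by rewrite eqxx.
rewrite inE => Gg; have [_|] := leP (r i - `|x g - c i|) 0; first by rewrite eqxx.
by rewrite subr_gt0.
Qed.

Lemma bumpE i g x : Gam i g -> `|x g - c i| < r i -> bump i g x = r i - `|x g - c i|.
Proof.
by move=> Gg xr; rewrite /bump ifT ?inE//; apply/max_idPl; rewrite subr_ge0 ltW.
Qed.

Lemma bump_eq i g x y : x g = y g -> bump i g x = bump i g y.
Proof. by rewrite /bump => ->. Qed.

Lemma bump_continuous i g : continuous (bump i g).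
Proof.
have ev : continuous (fun x : {ptws Gamma -> R} => x g : R).
  exact: continuous_ptws_eval.
suff gen (T : topologicalType) (f : T -> R) : continuous f ->
    continuous (fun t => if g \in Gam i then Num.max (r i - `|f t - c i|) 0 else 0).
  exact: gen ev.
move=> cf; case: (g \in Gam i) => t; last exact: cvg_cst.
apply: (@continuous_max R T); last exact: cvg_cst.
apply: cvgB; first exact: cvg_cst.
by apply: cvg_norm; apply: cvgB; [exact: cf|exact: cvg_cst].
Qed.

Context (K : set {ptws Gamma -> R}).
Hypothesis sys : bump_system K Gam c r.

Lemma bump_le1 i g x : bump i g x <= 1.
Proof.
have [->//|/bump_neq0[Gg xr]] := eqVneq (bump i g x) 0.
have [/(_ _ _ Gg)[/andP[_ r1] _] _ _] := sys.
by rewrite bumpE// (le_trans _ r1)// gerBl.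
Qed.

Lemma normr_bump_le1 i g x : `|bump i g x| <= 1.
Proof. by rewrite ger0_norm ?bump_ge0// bump_le1. Qed.

Lemma bump_at0 i g x : x g = 0 -> bump i g x = 0.
Proof.
move=> xg; have [->//|/bump_neq0[Gg xr]] := eqVneq (bump i g x) 0.
have [/(_ _ _ Gg)[_ rc] _ _] := sys.
by move: xr; rewrite xg sub0r normrN => /(lt_trans rc); rewrite ltxx.
Qed.

Lemma bump_finite i x : K x -> finite_set [set g | bump i g x != 0].
Proof.
move=> Kx; have [_ /(_ i _ Kx) fin _] := sys.
by apply: sub_finite_set fin => g /bump_neq0[Gg /ltW].
Qed.

(** At a coordinate where one point is nonzero, some bump of radius below half the distance of the
    two values is positive at that point; it then vanishes at the other. *)
Lemma bump_separating x y : K x -> K y -> (forall i g, bump i g x = bump i g y) -> x = y.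
Proof.
have [_ _ sep] := sys.
suff le z w g : K z -> z g != 0 -> (forall i g, bump i g z = bump i g w) -> z g = w g.
  move=> Kx Ky xy; apply/funext => g.
  have [xg|xg] := eqVneq (x g) 0; last exact: le.
  by have [yg|yg] := eqVneq (y g) 0; [rewrite xg yg|apply/esym/le].
move=> Kz zg zw; apply: contrapT => /eqP zwg.
have d0 : 0 < `|z g - w g| / 2 by rewrite divr_gt0// normr_gt0 subr_eq0.
have [i [Gg zr rd]] := sep _ _ _ Kz zg d0.
have /bump_neq0[_ wr] : bump i g w != 0.
  by rewrite -zw bumpE// subr_eq0 gt_eqF.
have := ler_distD (c i) (z g) (w g); rewrite (distrC (c i)); lra.
Qed.

End bump.

(** * Banach spaces of bounded functions *)

Section closed_span.
Context {R : realType} {J S : Type} (b : J -> S -> R).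

Inductive lspan : (S -> R) -> Prop :=
| lspan0 : lspan (fun=> 0)
| lspanD a j u : lspan u -> lspan (fun s => a * b j s + u s).

Lemma lspan_lin a u v : lspan u -> lspan v -> lspan (fun s => a * u s + v s).
Proof.
move=> su sv; elim: su => [|a' j u' _ IH].
  by rewrite (_ : (fun _ => _) = v)//; apply/funext => s; rewrite mulr0 add0r.
rewrite (_ : (fun _ => _) = fun s => (a * a') * b j s + (a * u' s + v s)).
  exact: lspanD.
by apply/funext => s; rewrite mulrDr mulrA addrA.
Qed.

Definition cspan_mem : {pred (S -> R)} := fun v => `[<
  (exists M, forall s, `|v s| <= M) /\
  forall eps, 0 < eps -> exists2 u, lspan u & forall s, `|v s - u s| <= eps >].

Lemma cspan_submod_closed : submod_closed cspan_mem.
Proof.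
split=> [|a u v /asboolP[[M uM] ua] /asboolP[[N vN] va]]; apply/asboolP; split.
- by exists 0 => s; rewrite normr0.
- move=> eps eps0; exists (fun=> 0); first exact: lspan0.
  by move=> s; rewrite subrr normr0 ltW.
- exists (`|a| * M + N) => s; rewrite (le_trans (ler_normD _ _))// lerD//.
  by rewrite normrM ler_wpM2l.
- move=> eps eps0; have a0 : 0 < 2 * (`|a| + 1) by rewrite mulr_gt0// ltr_wpDl.
  have [|u' su' uu'] := ua (eps / (2 * (`|a| + 1))); first exact: divr_gt0.
  have [|v' sv' vv'] := va (eps / 2); first by rewrite divr_gt0.
  exists (fun s => a * u' s + v' s); first exact: lspan_lin.
  move=> s; rewrite -[(a *: u + v) s]/(a * u s + v s).
  rewrite (_ : _ - _ = a * (u s - u' s) + (v s - v' s)); last by ring.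
  rewrite (le_trans (ler_normD _ _))// [eps]splitr lerD// normrM.
  rewrite (le_trans (ler_wpM2l _ (uu' s)))//.
  have -> : `|a| * (eps / (2 * (`|a| + 1))) = eps / 2 * (`|a| / (`|a| + 1)).
    by rewrite invfM; ring.
  rewrite ler_piMr//; first by rewrite ltW// divr_gt0.
  by rewrite ler_pdivrMr ?ltr_wpDl// mul1r lerDl.
Qed.

HB.instance Definition _ :=
  GRing.isSubmodClosed.Build _ _ cspan_mem cspan_submod_closed.

Record cspan : Type := CSpan {cspan_val :> S -> R; cspan_valP : cspan_val \in cspan_mem}.

HB.instance Definition _ := [isSub for cspan_val].
HB.instance Definition _ := [Choice of cspan by <:].
HB.instance Definition _ := [SubChoice_isSubLmodule of cspan by <:].

Lemma cspan_linE a (u v : cspan) s : (a *: u + v) s = a * u s + v s.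
Proof. by []. Qed.

(** Adding the value 0 makes the supremum meaningful when [S] is empty. *)
Definition cspan_norm (v : cspan) : R := sup [set y | y = 0 \/ exists s, y = `|v s|].

Let has_sup_cspan_norm (v : cspan) : has_sup [set y | y = 0 \/ exists s, y = `|v s|].
Proof.
split; first by exists 0; left.
have /asboolP[[M vM] _] := cspan_valP v.
exists `|M| => _ [->//|[s ->]]; exact: le_trans (vM s) (ler_norm _).
Qed.

Lemma cspan_norm_ge (v : cspan) s : `|v s| <= cspan_norm v.
Proof. by apply: sup_upper_bound => //; right; exists s. Qed.

Lemma cspan_norm_le (v : cspan) M : 0 <= M -> (forall s, `|v s| <= M) -> cspan_norm v <= M.
Proof.
by move=> M0 vM; apply: ge_sup => [|_ [->//|[s ->]//]]; exists 0; left.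
Qed.

Let cspan_norm_ge0 (v : cspan) : 0 <= cspan_norm v.
Proof. by apply: sup_upper_bound => //; left. Qed.

Let cspan_ler_normD (u v : cspan) : cspan_norm (u + v) <= cspan_norm u + cspan_norm v.
Proof.
apply: cspan_norm_le => [|s]; first exact: addr_ge0.
by rewrite (le_trans (ler_normD _ _))// lerD// cspan_norm_ge.
Qed.

Let cspan_normrZ (l : R) (v : cspan) : cspan_norm (l *: v) = `|l| * cspan_norm v.
Proof.
have le k (u : cspan) : cspan_norm (k *: u) <= `|k| * cspan_norm u.
  apply: cspan_norm_le => [|s]; first exact: mulr_ge0.
  by rewrite normrM ler_wpM2l// cspan_norm_ge.
apply/eqP; rewrite eq_le le/=.
have [->|l0] := eqVneq l 0; first by rewrite normr0 mul0r.
by rewrite -ler_pdivlMl ?normr_gt0// -normfV -{1}[v](scalerK l0) le.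
Qed.

Let cspan_normr0_eq0 (v : cspan) : cspan_norm v = 0 -> v = 0.
Proof.
move=> v0; apply: val_inj; apply/funext => s; apply/eqP.
by rewrite -normr_le0 -v0 cspan_norm_ge.
Qed.

HB.instance Definition _ :=
  Lmodule_isNormed.Build R cspan cspan_ler_normD cspan_normrZ cspan_normr0_eq0.

Lemma cspan_complete (F : set_system cspan) : ProperFilter F -> cauchy F -> cvg F.
Proof.
move=> PF /cauchyP Fc.
have near_u eps : 0 < eps -> exists u : cspan, F [set w : cspan | forall s, `|u s - w s| <= eps].
  move=> /Fc[u Fu]; exists u; apply: filterS Fu => w; rewrite /ball/= => /ltW uw s.
  exact: le_trans (cspan_norm_ge (u - w) s) uw.
have cvs s : cvg ((fun u : cspan => u s) @ F).
  apply/cauchy_cvgP/cauchyP => eps eps0.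
  have [|u Fu] := near_u (eps / 2); first by rewrite divr_gt0.
  exists (u s); suff : F [set w : cspan | ball (u s) eps (w s)] by [].
  apply: filterS Fu => w /(_ s) /= uw.
  rewrite /ball/= (le_lt_trans uw)//.
  by rewrite ltr_pdivrMr// ltr_pMr// ltr1n.
pose v s := lim ((fun u : cspan => u s) @ F).
have vu (u : cspan) eps : F [set w : cspan | forall s, `|u s - w s| <= eps] ->
    forall s, `|v s - u s| <= eps.
  move=> Fu s; rewrite distrC.
  have cn : (fun w : cspan => `|u s - w s|) @ F --> `|u s - v s|.
    by apply: cvg_norm; apply: cvgB; [exact: cvg_cst|exact: cvs].
  apply: (cvgr_to_le cn); apply: filterS Fu => w; exact.
have vV : v \in cspan_mem.
  apply/asboolP; split=> [|eps eps0].
    have [u Fu] := near_u 1 ltr01; exists (cspan_norm u + 1) => s.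
    rewrite -[v s](subrK (u s)) addrC (le_trans (ler_normD _ _))// lerD//.
      exact: cspan_norm_ge.
    exact: vu.
  have [|u Fu] := near_u (eps / 2); first by rewrite divr_gt0.
  have /asboolP[_ /(_ (eps / 2))[|u' su' uu']] := cspan_valP u.
    by rewrite divr_gt0.
  exists u' => // s; rewrite (le_trans (ler_distD (u s) _ _))// [eps]splitr lerD//.
  exact: vu.
apply/cvg_ex; exists (CSpan vV); apply/cvgrPdist_le => eps eps0.
have [|u Fu] := near_u (eps / 2); first by rewrite divr_gt0.
apply: filterS (Fu) => w /= uw; apply: cspan_norm_le => [|s]; first exact: ltW.
rewrite (le_trans (ler_distD (u s) _ _))// [leRHS]splitr lerD//.
exact: (vu _ _ Fu).
Qed.

HB.instance Definition _ := Uniform_isComplete.Build cspan cspan_complete.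

Lemma cspan_normE (v : cspan) : `|v| = cspan_norm v. Proof. by []. Qed.

Lemma ler_cspan_norm (v : cspan) s : `|v s| <= `|v|.
Proof. exact: cspan_norm_ge. Qed.

Lemma lspan_mem (u : S -> R) M : (forall s, `|u s| <= M) -> lspan u -> u \in cspan_mem.
Proof.
move=> uM su; apply/asboolP; split; first by exists M.
by move=> eps eps0; exists u => // s; rewrite subrr normr0 ltW.
Qed.

Lemma cspan_gen_mem j M : (forall s, `|b j s| <= M) -> b j \in cspan_mem.
Proof.
move=> bM; apply: (lspan_mem bM).
rewrite (_ : b j = fun s => 1 * b j s + (fun=> 0) s); first exact/lspanD/lspan0.
by apply/funext => s; rewrite mul1r addr0.
Qed.

End closed_span.

Lemma continuous_uniform_limit {R : realType} (T : topologicalType) (f : T -> R) :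
  (forall eps, 0 < eps -> exists2 k : T -> R, continuous k &
     forall t, `|f t - k t| <= eps) -> continuous f.
Proof.
move=> fk t; apply/cvgrPdist_lt => eps eps0.
have [|k ck kP] := fk (eps / 4); first by rewrite divr_gt0.
have /cvgrPdist_lt/(_ (eps / 4)) := ck t.
rewrite divr_gt0// => /(_ isT); apply: filterS => s ks.
have := kP t; have := kP s; rewrite (distrC _ (k s)) => h1 h2.
have := ler_distD (k t) (f t) (f s); have := ler_distD (k s) (k t) (f s).
by move: ks; lra.
Qed.

(** * The space c_0 and its weak topology *)

Section c0.
Context {R : realType} {J : choiceType}.

(** The unit vectors, whose closed span in the bounded functions is c_0 on [J]. *)
Definition coord_gen (j s : J) : R := (j == s)%:R.

Local Notation c0 := (cspan coord_gen).

Lemma lspan_coord_genP (u : J -> R) : lspan coord_gen u <->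
  exists s : seq J, forall j, j \notin s -> u j = 0.
Proof.
split.
  elim=> [|a j v _ [s vs]]; first by exists [::].
  exists (j :: s) => k; rewrite inE negb_or => /andP[kj ks].
  by rewrite /coord_gen eq_sym (negbTE kj) mulr0 add0r vs.
case=> s; elim: s u => [|k s IHs] u us.
  rewrite (_ : u = fun=> 0); first exact: lspan0.
  by apply/funext => j; exact: us.
have := IHs (fun j => if j == k then 0 else u j).
have H j : j \notin s -> (if j == k then 0 else u j) = 0.
  by case: eqVneq => // jk js; apply: us; rewrite inE negb_or jk.
move=> /(_ H) /(lspanD (u k) k); congr lspan; apply/funext => j.
rewrite /coord_gen eq_sym; case: eqVneq => [->|_]; first by rewrite mulr1 addr0.
by rewrite mulr0 add0r.
Qed.

Lemma c0_mem (v : J -> R) :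
  (forall eps, 0 < eps -> finite_set [set j | eps < `|v j|]) ->
  v \in cspan_mem coord_gen.
Proof.
move=> vfin; have approx eps : 0 < eps ->
    exists2 u, lspan coord_gen u & forall j, `|v j - u j| <= eps.
  move=> eps0; have /finite_seqP[s sE] := vfin eps eps0.
  exists (fun j => if j \in s then v j else 0).
    by apply/lspan_coord_genP; exists s => j /negbTE ->.
  move=> j; case: ifPn => js; first by rewrite subrr normr0 ltW.
  rewrite subr0 leNgt; apply: contraNN js => vj.
  by have : [set` s] j by rewrite -sE.
apply/asboolP; split=> //.
have [u /lspan_coord_genP[s us] vu] := approx 1 ltr01.
exists (1 + \sum_(j <- s) `|u j|) => j.
rewrite -[v j](subrK (u j)) (le_trans (ler_normD _ _))// lerD//.
have [js|js] := boolP (j \in s); last by rewrite us// normr0 sumr_ge0.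
by rewrite (big_rem j)//= lerDl sumr_ge0.
Qed.

Lemma c0_tail (v : c0) eps : 0 < eps ->
  exists s : seq J, forall j, j \notin s -> `|v j| <= eps.
Proof.
move=> eps0; have /asboolP[_ /(_ _ eps0)[u /lspan_coord_genP[s us] vu]] := cspan_valP v.
by exists s => j js; have := vu j; rewrite us// subr0.
Qed.

(* A nearly norming vector [u] of [phi] is small off a finite set [s], so that
   adding to it a vector of the unit ball supported off [s] nearly keeps the
   norm: [phi] is then small on such vectors. *)
Lemma c0_dual_tail (phi : dual c0) eps : 0 < eps -> exists s : seq J,
  forall v : c0, `|v| <= 1 -> (forall j, j \in s -> v j = 0) ->
    `|set_val phi v| <= eps.
Proof.
move=> eps0.
have [pl _] : dual c0 (set_val phi) by exact: set_valP.
have [n pn] := dual_bound (set_valP phi).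
have pZ a v : set_val phi (a *: v) = a * set_val phi v.
  have p0 : set_val phi 0 = 0.
    by apply/eqP; rewrite -normr_le0 (le_trans (pn 0))// normr0 mulr0.
  by have := pl a v 0; rewrite addr0 p0 addr0.
have pD u v : set_val phi (u + v) = set_val phi u + set_val phi v.
  by have := pl 1 u v; rewrite scale1r mul1r.
pose B := [set set_val phi u | u in [set u : c0 | `|u| <= 1]].
have supB : has_sup B.
  split; first by exists (set_val phi 0), 0 => //=; rewrite normr0.
  exists n%:R => _ [u /= u1 <-].
  by rewrite (le_trans (ler_norm _))// (le_trans (pn u))// ler_piMr.
pose M := sup B.
have M0 : 0 <= M.
  apply: sup_upper_bound => //; exists 0; first by rewrite /= normr0.
  by rewrite -(scale0r (0 : c0)) pZ mul0r.
have [|_ [u /= u1 <-] uM] := @sup_adherent _ B (eps / 2) _ supB.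
  by rewrite divr_gt0.
rewrite -/M in uM.
have M1 : 0 < 2 * (M + 1) by lra.
(* Makes [M * e'] at most [eps / 2]; the other half of [eps] pays for [u] being only nearly
   norming. *)
pose e' := eps / (2 * (M + 1)).
have e'0 : 0 < e' by rewrite divr_gt0.
have [s us] := c0_tail u e'0.
exists s => v v1 vs.
suff le (w : c0) : `|w| <= 1 -> (forall j, j \in s -> w j = 0) -> set_val phi w <= eps.
  rewrite ler_norml le// andbT lerNl -mulN1r -pZ scaleN1r le// ?normrN// => j js.
  by rewrite -scaleN1r -[LHS]/(-1 * v j) vs ?mulr0.
move=> w1 ws.
have uw1 : `|u + w| <= 1 + e'.
  rewrite cspan_normE; apply: cspan_norm_le => [|j]; first by lra.
  rewrite -[(u + w) j]/(u j + w j) (le_trans (ler_normD _ _))//.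
  have [js|js] := boolP (j \in s).
    rewrite ws// normr0; apply: lerD; last exact: ltW.
    exact: le_trans (ler_cspan_norm _ _) u1.
  rewrite addrC; apply: lerD; last exact: us.
  exact: le_trans (ler_cspan_norm _ _) w1.
have : set_val phi (u + w) <= M * (1 + e').
  have e1 : 0 < 1 + e' by lra.
  have : set_val phi ((1 + e')^-1 *: (u + w)) <= M.
    apply: sup_upper_bound => //; exists ((1 + e')^-1 *: (u + w)) => //=.
    by rewrite normrZ gtr0_norm ?invr_gt0// ler_pdivrMl// mulr1.
  by rewrite pZ ler_pdivrMl// mulrC.
have Me : M * e' <= eps / 2.
  have -> : eps / 2 = (M + 1) * e'.
    by rewrite /e' invfM; field; rewrite gt_eqF//; lra.
  by rewrite ler_wpM2r ?ltW//; lra.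
by rewrite pD; lra.
Qed.

(** On the unit ball of c_0 the weak topology is the pointwise one: by [c0_dual_tail], a functional
    is determined up to [eps] by finitely many coordinates, uniformly on the ball. The function [w]
    keeps just these coordinates of [f]. *)
Lemma continuous_c0_weak (T : topologicalType) (f : T -> c0) :
  (forall j, continuous (fun t => f t j)) -> (forall t, `|f t| <= 1) ->
  continuous (f : T -> weak c0).
Proof.
move=> cf f1; apply: continuous_weak => phi.
have [pl _] : dual c0 (set_val phi) by exact: set_valP.
apply: continuous_uniform_limit => eps eps0.
have [s sP] := c0_dual_tail phi eps0.
suff [w [wP w0 cw]] : exists w : T -> c0,
    [/\ forall t j, j \in s -> w t j = f t j, forall t j, j \notin s -> w t j = 0 &
        continuous (fun t => set_val phi (w t))].
  exists (fun t => set_val phi (w t)) => // t.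
  rewrite -(dualB _ _ (set_valP phi)); apply: sP => [|j js].
    rewrite cspan_normE; apply: cspan_norm_le => // j.
    rewrite -[(f t - w t) j]/(f t j - w t j).
    have [js|js] := boolP (j \in s); first by rewrite wP// subrr normr0.
    by rewrite w0// subr0 (le_trans (ler_cspan_norm _ _)).
  by rewrite -[(f t - w t) j]/(f t j - w t j) wP// subrr.
elim: s {sP} => [|j s [w [wP w0 cw]]].
  by exists (fun=> 0); split=> // t; exact: cvg_cst.
have [js|js] := boolP (j \in s).
  exists w; split=> // t k.
    by rewrite inE => /predU1P[->|]; exact: wP.
  by rewrite inE negb_or => /andP[_]; exact: w0.
have gm : coord_gen j \in cspan_mem coord_gen.
  apply: (@cspan_gen_mem _ _ _ _ _ 1) => k.
  by rewrite /coord_gen; case: eqP; rewrite ?normr1 ?normr0.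
exists (fun t => f t j *: CSpan gm + w t); split.
- move=> t k; rewrite cspan_linE/= /coord_gen inE (eq_sym j).
  have [->|kj /= ks] := eqVneq k j; first by rewrite mulr1 w0// addr0.
  by rewrite wP// mulr0 add0r.
- move=> t k; rewrite cspan_linE/= /coord_gen inE negb_or (eq_sym j) => /andP[kj ks].
  by rewrite w0// (negbTE kj) mulr0 addr0.
- rewrite (_ : (fun _ => _) = fun t => set_val phi (CSpan gm) * f t j + 1 * set_val phi (w t)).
    exact: continuous_lin.
  by apply/funext => t; rewrite pl mul1r mulrC.
Qed.

Lemma hausdorff_weak_cspan (I S : Type) (b : I -> S -> R) :
  hausdorff_space (weak (cspan b)).
Proof.
apply: (@hausdorff_separating R) => v w vw; apply: contrapT => nh; apply: vw.
apply: val_inj; apply/funext => s; apply: contrapT => vws; apply: nh.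
have es : dual (cspan b) (fun v => v s).
  by apply: (@bound_dual _ _ _ 1) => // u; rewrite mul1r; exact: ler_cspan_norm.
exists (fun v : weak (cspan b) => (v : cspan b) s) => //.
exact: (@weak_continuous R (cspan b) (SigSub (mem_set es))).
Qed.

End c0.

(** The factor [2^-1 ^+ i] leaves finitely many [i] with values above [eps], and for each of them
    the bumps are point-finite, so [F x] belongs to c_0. *)
Lemma bump_system_Eberlein {R : realType} (Gamma : Type) (K : set {ptws Gamma -> R})
    (Gam : nat -> set Gamma) (c r : nat -> R) :
  compact K -> bump_system K Gam c r -> Eberlein R K.
Proof.
move=> cK sys; pose J : choiceType := (nat * {classic Gamma})%type.
pose F (x : K) (j : J) : R := 2^-1 ^+ j.1 * bump Gam c r j.1 j.2 (set_val x).
have F0 x j : 0 <= F x j by rewrite mulr_ge0 ?bump_ge0// exprn_ge0.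
have FE x j : `|F x j| <= 2^-1 ^+ j.1.
  by rewrite ger0_norm// ler_piMr ?exprn_ge0// (bump_le1 sys).
have Fmem x : F x \in cspan_mem (@coord_gen R J).
  apply: c0_mem => eps eps0.
  have [N Neps] : exists N, 2^-1 ^+ N < eps :> R.
  have half1 : `|2^-1 : R| < 1 by rewrite ger0_norm ?invf_lt1 ?ltr1n// invr_ge0.
    have /cvgrPdist_lt/(_ _ eps0)[N _ /(_ N (leqnn N))] := cvg_expr half1.
    by rewrite /= sub0r normrN ger0_norm ?exprn_ge0// => HN; exists N.
  apply: (@sub_finite_set _ _ (\bigcup_(i in `I_N)
      [set (i, g : {classic Gamma}) | g in [set g | bump Gam c r i g (set_val x) != 0]])).
    move=> [i g] /= epsF; exists i => /=.
      rewrite ltnNge; apply/negP => Ni.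
      have := lt_trans Neps (lt_le_trans epsF (FE x (i, g))).
      by rewrite /= ltNge ler_wiXn2l// ?invr_ge0// invf_le1// ler1n.
    exists g => //=; apply/eqP => b0.
    by move: epsF; rewrite /F /= b0 mulr0 normr0 ltNge ltW.
  apply: bigcup_finite => [|i _]; first exact: finite_II.
  apply: finite_image; apply: (bump_finite sys); exact: set_valP.
pose f x : cspan (@coord_gen R J) := CSpan (Fmem x).
have cf : continuous (f : K -> weak (cspan (@coord_gen R J))).
  apply: continuous_c0_weak => [j|x].
    apply: continuous_mull => x.
    exact: (continuous_comp (@continuous_set_val _ K x) (@bump_continuous _ _ _ _ _ _ _ _)).
  rewrite cspan_normE; apply: cspan_norm_le => // j.
  by rewrite (le_trans (FE x j))// exprn_ile1// ?invr_ge0// invf_le1// ler1n.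
have fI : injective (f : K -> weak (cspan (@coord_gen R J))).
  move=> x y fxy; apply: val_inj.
  apply: (bump_separating sys); [exact: set_valP|exact: set_valP|] => i g.
  have : F x (i, g) = F y (i, g) by rewrite -[F x]/(cspan_val (f x)) fxy.
  by move/mulfI; apply; rewrite expf_neq0.
have cKT := compact_setT_set_type cK.
have [h hh _] := homeomorphic_range cKT (@hausdorff_weak_cspan R J J _) cf fI.
exists (cspan (@coord_gen R J)), (range (f : K -> weak (cspan (@coord_gen R J)))).
split; first exact: compact_range.
by exists h.
Qed.

(** * Spaces without copies of ell1 *)

Section Simons.
Context {R : realType} (V : completeNormedModType R) (w : nat -> V).

(** Iterated midpoints give the convex combinations with dyadic weights, which match the weights
    [2^-n] of the series below. *)
Inductive tail_hull (n : nat) : V -> Prop :=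
| tail_hull_mem k : (n <= k)%N -> tail_hull n (w k)
| tail_hull_mid u v : tail_hull n u -> tail_hull n v ->
    tail_hull n (2^-1 *: (u + v)).

Lemma tail_hull_le m n v : (m <= n)%N -> tail_hull n v -> tail_hull m v.
Proof.
move=> mn; elim=> [k nk|u z _ ? _ ?]; last exact: tail_hull_mid.
exact/tail_hull_mem/(leq_trans mn).
Qed.

Lemma tail_hull_bound (p : V -> R) n c v :
  (forall u z, p (2^-1 *: (u + z)) <= 2^-1 * (p u + p z)) ->
  (forall k, (n <= k)%N -> p (w k) <= c) -> tail_hull n v -> p v <= c.
Proof.
move=> pmid pc; elim=> [k nk|u z _ uc _ zc]; first exact: pc.
by apply: le_trans (pmid _ _) _; lra.
Qed.

(* Simons' argument: the vectors [y n] nearly minimize the norm of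
   [S n + 2 * 2^-n y] over the hull of the tail, where [S n] is the sum of
   [2^-k y k] for [k < n].  The total sum [S] then has a norm at least
   [m / 2^n] larger than that of [S n], so at a point where [S] attains its
   norm the remaining tail is at least [m / 2^n], whereas pointwise
   convergence to [0] makes it smaller. *)
Lemma tail_hull_small (X : Type) (ev : X -> V -> R) (C m : R) :
  (forall x, scalar (ev x)) -> (forall x v, `|ev x v| <= `|v|) ->
  (forall v, exists x, `|v| <= `|ev x v|) ->
  (forall k, `|w k| <= C) -> (forall x, (fun k => ev x (w k)) @ \oo --> (0 : R)) ->
  0 < m -> exists2 v, tail_hull 0 v & `|v| < m.
Proof.
move=> evl ev1 att wC w0 m0; apply: contrapT => nv.
have mv v : tail_hull 0 v -> m <= `|v|.
  by move=> hv; rewrite leNgt; apply/negP => vm; apply: nv; exists v.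
pose h n : R := 2^-1 ^+ n.
have h0 n : 0 < h n by rewrite exprn_gt0// invr_gt0.
have hS n : h n = 2 * h n.+1 by rewrite /h exprS mulrA mulfV ?mul1r.
(* The slack is quadratic in [h n]: in [gap] the errors then add up to [m * (1 - h n)] only, against
   [2 * m <= |s|]. *)
have near_min n (s : V) : exists y, tail_hull n y /\ forall z, tail_hull n z ->
    `|s + (2 * h n) *: y| <= `|s + (2 * h n) *: z| + m * h n * h n / 2.
  pose B := [set `|s + (2 * h n) *: z| | z in tail_hull n].
  have infB : has_inf B.
    split; first by exists `|s + (2 * h n) *: w n|, (w n) => //; exact: tail_hull_mem.
    by exists 0 => _ [z _ <-].
  have [|_ [y hy <-] yB] := @inf_adherent _ B (m * h n * h n / 2) _ infB.
    by rewrite divr_gt0// !mulr_gt0.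
  exists y; split=> // z hz; rewrite (le_trans (ltW yB))// lerD2r.
  by apply: inf_lbound; [case: infB|exists z].
have [y0 y0P] : exists y : nat * V -> V, forall ns, tail_hull ns.1 (y ns) /\
    forall z, tail_hull ns.1 z -> `|ns.2 + (2 * h ns.1) *: y ns| <=
      `|ns.2 + (2 * h ns.1) *: z| + m * h ns.1 * h ns.1 / 2.
  have all (ns : nat * V) := near_min ns.1 ns.2.
  by have [y yP] := choice all; exists y.
pose S := fix S n := if n is n'.+1 then S n' + h n' *: y0 (n', S n') else 0.
pose y n := y0 (n, S n).
have SS n : S n.+1 = S n + h n *: y n by [].
have hy n : tail_hull n (y n) by have [] := y0P (n, S n).
have ymin n z : tail_hull n z ->
    `|S n + (2 * h n) *: y n| <= `|S n + (2 * h n) *: z| + m * h n * h n / 2.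
  by have [_] := y0P (n, S n); apply.
have hC n v : tail_hull n v -> `|v| <= C.
  apply: (@tail_hull_bound (fun v => `|v|) n) => [u z|k _]; last exact: wC.
  by rewrite normrZ ger0_norm ?invr_ge0// ler_wpM2l ?invr_ge0// ler_normD.
(* The weights [h n], ..., [h N.-1] and [2 * h N] add up to [2 * h n]. Replacing the last two terms
   by their midpoint, over and over, leaves a single element of the hull. *)
have tailE n N z : (n <= N)%N -> tail_hull N z -> exists2 v, tail_hull n v &
    S N + (2 * h N) *: z = S n + (2 * h n) *: v.
  elim: N z => [|N IHN] z; first by rewrite leqn0 => /eqP ->; exists z.
  rewrite leq_eqVlt => /predU1P[->|]; first by exists z.
  rewrite ltnS => nN hz.
  have [|v hv vE] := IHN (2^-1 *: (y N + z)) nN.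
    by apply: tail_hull_mid => //; exact: tail_hull_le hz.
  exists v => //; rewrite -vE SS -hS scalerA -addrA -scalerDr.
  by rewrite mulrAC mulfV// mul1r.
have [s sS] : exists s : V, S @ \oo --> s.
  suff : cvgn S by move/cvg_ex.
  rewrite (_ : S = series (fun n => h n *: y n)); last first.
    apply/funext; elim=> [|n IHn]; first by rewrite /series/= big_geq.
    by rewrite SS IHn /series/= big_nat_recr.
  apply: normed_cvg; apply: (@series_le_cvg R _ (fun n => C * h n)) => [n|n|n|].
  - exact: normr_ge0.
  - by apply: mulr_ge0; [exact: le_trans (wC 0%N)|exact: ltW].
  - rewrite /= normrZ mulrC gtr0_norm//; apply: ler_wpM2r; first exact: ltW.
    exact: hC (hy n).
  - apply: is_cvg_geometric_series.
    by rewrite ger0_norm ?invr_ge0// invf_lt1// ltr1n.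
pose q n := S n + (2 * h n) *: y n.
have qs : q @ \oo --> s.
  have -> : q = (fun n => 2 *: S n.+1 - S n).
    apply/funext => n; rewrite /q SS scalerDr scalerA (_ : 2 *: S n = S n + S n).
      by rewrite [RHS]addrAC addrK.
    by rewrite scaler_nat.
  have -> : s = 2 *: s - s by rewrite scaler_nat mulr2n addrK.
  apply: cvgB => //; apply: cvgZ; first exact: cvg_cst.
  by rewrite cvg_shiftS.
(* For [N >= n], [tailE] makes [q N] one of the competitors in the choice of [y n]; then [N] tends
   to infinity. *)
have qn n : `|q n| <= `|s| + m * h n * h n / 2.
  rewrite -lerBlDr; apply: (cvgr_to_ge (cvg_norm qs)).
  exists n => // N /= nN; rewrite lerBlDr.
  have [z hz zE] := tailE n N (y N) nN (hy N).
  rewrite -[q N]/(S N + _) zE.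
  exact: ymin.
have s2 : 2 * m <= `|s|.
  apply: (cvgr_to_ge (cvg_norm qs)); exists 0%N => // N _.
  have [z hz zE] := tailE 0%N N (y N) (leq0n _) (hy N).
  rewrite -[q N]/(S N + _) zE.
  rewrite add0r normrZ /h expr0 mulr1 ger0_norm// ler_wpM2l//; exact: mv.
have gap n : `|S n| <= `|s| - h n * (`|s| - m * (1 - h n)).
  elim: n => [|n IHn]; first by rewrite normr0 /h expr0; lra.
  have -> : S n.+1 = 2^-1 *: (q n + S n).
    rewrite (_ : q n + S n = 2 *: S n.+1); first by rewrite scalerA mulVf// scale1r.
    by rewrite SS scalerDr scalerA scaler_nat mulr2n addrAC.
  rewrite normrZ gtr0_norm ?invr_gt0//.
  have := ler_normD (q n) (S n); have := qn n.
  move: IHn; rewrite (hS n); set t := h n.+1; set a := `|s|.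
  move: `|S n| `|q n| `|q n + S n| => b d e h1 h2 h3.
  have : 2^-1 * e <= 2^-1 * (d + b) by rewrite ler_wpM2l// invr_ge0.
  by move=> h4; apply: le_trans h4 _; nra.
have [x xs] := att s.
have [N _ Nw] : \forall k \near \oo, `|ev x (w k)| <= m / 4.
  have m4 : 0 < m / 4 by rewrite divr_gt0.
  have /cvgrPdist_le/(_ _ m4) := w0 x.
  by apply: filterS => k; rewrite sub0r normrN.
have evD u v : ev x (u + v) = ev x u + ev x v.
  by have := evl x 1 u v; rewrite scale1r mul1r.
have ev0 : ev x 0 = 0 by apply/eqP; rewrite -normr_le0 -(normr0 V) ev1.
have evZ a v : ev x (a *: v) = a * ev x v.
  by have := evl x a v 0; rewrite !addr0 ev0 addr0.
(* From [N] on, all [w k] have values at most [m / 4] at [x], hence so has the hull element that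
   represents the tail. *)
have evs : `|ev x s| <= `|S N| + (2 * h N) * (m / 4).
  have c : ev x (q n) @[n --> \oo] --> ev x s.
    apply/cvgrPdist_le => eps eps0.
    have /cvgrPdist_le/(_ _ eps0) := qs; apply: filterS => n; apply: le_trans.
    by rewrite -mulN1r -evZ -evD scaleN1r ev1.
  apply: (cvgr_to_le (cvg_norm c)); exists N => // n /= Nn.
  have [z hz zE] := tailE N n (y n) Nn (hy n).
  rewrite -[q n]/(S n + _) zE.
  have b1 : `|ev x z| <= m / 4.
    have := @tail_hull_bound (fun v => `|ev x v|) N (m / 4) z; apply=> // u v.
    by rewrite evZ normrM gtr0_norm ?invr_gt0// evD ler_wpM2l ?invr_ge0// ler_normD.
  have b2 : `|2 * h N * ev x z| <= 2 * h N * (m / 4).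
    have hN : 0 < 2 * h N by rewrite mulr_gt0.
    by rewrite normrM (gtr0_norm hN) (ler_pM2l hN).
  rewrite evD evZ; exact: le_trans (ler_normD _ _) (lerD (ev1 _ _) b2).
have := gap N; have := h0 N; have : h N <= 1.
  by rewrite exprn_ile1// ?invr_ge0// invf_le1// ler1n.
move: (h N) xs evs => t xs evs t1 t0 gN.
have : t * (`|s| - m * (1 - t)) <= t * (m / 2) by lra.
by rewrite ler_pM2l//; nra.
Qed.

End Simons.

(** A linear relation between finitely many evaluations passes from the generators to the span by
    linearity, and to the closure by uniform approximation. *)
Lemma cspan_comb0 {R : realType} (J S : Type) (b : J -> S -> R) (L : seq (R * S))
    (v : cspan b) :
  (forall j, \sum_(t <- L) t.1 * b j t.2 = 0) -> \sum_(t <- L) t.1 * v t.2 = 0.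
Proof.
move=> Lb; have Lu u : lspan b u -> \sum_(t <- L) t.1 * u t.2 = 0.
  elim=> [|a j z _ IH]; first by rewrite big1// => t _; rewrite mulr0.
  rewrite (eq_bigr (fun t => a * (t.1 * b j t.2) + t.1 * z t.2)) => [|t _]; last by ring.
  by rewrite big_split/= -mulr_sumr Lb IH mulr0 addr0.
apply: contrapT => /eqP; rewrite -normr_gt0; set d := `|_| => d0.
pose A := \sum_(t <- L) `|t.1|.
have A0 : 0 <= A by apply: sumr_ge0.
have e0 : 0 < d / (A + 1) by rewrite divr_gt0//; lra.
have /asboolP[_ /(_ _ e0)[u su vu]] := cspan_valP v.
have : d <= A * (d / (A + 1)).
  have dE : d = `|\sum_(t <- L) t.1 * (v t.2 - u t.2)|.
    congr (`|_|); rewrite [RHS](eq_bigr (fun t => t.1 * v t.2 - t.1 * u t.2)).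
      by rewrite sumrB (Lu u su) subr0.
    by move=> t _; rewrite mulrBr.
  rewrite {1}dE mulr_suml (le_trans (ler_norm_sum _ _ _))//; apply: ler_sum => t _.
  by rewrite normrM ler_wpM2l.
rewrite mulrA ler_pdivlMr; last by lra.
nra.
Qed.

(** The sequence returns arbitrarily late to any neighborhood of a cluster point [f] in the product.
    The pairs are chosen successively, the [n]-th one close to [f] at the first [n] points. *)
Lemma close_pairs {R : realType} (X : Type) (v : nat -> X -> R) (C : R) (pt : nat -> X) :
  (forall k s, `|v k s| <= C) ->
  exists a b : nat -> nat, [/\ forall k, (a k < b k < a k.+1)%N &
    forall m, (fun k => v (b k) (pt m) - v (a k) (pt m)) @ \oo --> (0 : R)].
Proof.
move=> vC.
have [f _ fP] := @compact_sequence_cluster R {ptws X -> R} _ v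
  (@compact_bounded_functions R X (fun=> C)) vC.
have near n (d : R) N : 0 < d ->
    exists2 k, (N <= k)%N & forall m, (m < n)%N -> `|v k (pt m) - f (pt m)| < d.
  (* If no late [v k] were close to [f], this function would be at most [- d] along the sequence,
     hence at [f], where it is 0. *)
  move=> d0; pose h (z : {ptws X -> R}) := - \sum_(m < n) `|z (pt m) - f (pt m)|.
  have ch : continuous h.
    have ev s : continuous (fun z : {ptws X -> R} => z s : R).
      exact: (@continuous_ptws_eval X R).
    suff gen (T : topologicalType) (e : nat -> T -> R) : (forall m, continuous (e m)) ->
        continuous (fun t => - \sum_(m < n) `|e m t - f (pt m)|).
      exact: gen (fun m (z : {ptws X -> R}) => z (pt m)) (fun m => ev (pt m)).
    move=> ce; apply: continuous_opp; elim: n {h} => [|n IHn].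
      rewrite (_ : (fun _ => _) = fun=> 0); first by move=> t; exact: cvg_cst.
      by apply/funext => t; rewrite big_ord0.
    rewrite (_ : (fun _ => _) = fun t => 1 * (\sum_(m < n) `|e m t - f (pt m)|)
        + 1 * `|e n t - f (pt n)|).
      apply: continuous_lin => // t; apply: cvg_norm.
      by apply: cvgB; [exact: ce|exact: cvg_cst].
    by apply/funext => t; rewrite big_ord_recr/= !mul1r.
  apply: contrapT => nk.
  have : h f <= - d.
    apply: (fP h _ N ch) => k Nk; rewrite lerN2 leNgt; apply/negP => kd.
    apply: nk; exists k => // m mn; apply: le_lt_trans kd.
    by rewrite (bigD1 (Ordinal mn))//= lerDl sumr_ge0.
  by rewrite /h big1 => [|m _]; [lra|rewrite subrr normr0].
have step n N : exists ab : nat * nat, [/\ (N < ab.1)%N, (ab.1 < ab.2)%N &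
    forall m, (m < n)%N -> `|v ab.2 (pt m) - v ab.1 (pt m)| <= n.+1%:R^-1].
  have d0 : (0 : R) < n.+1%:R^-1 / 2 by rewrite divr_gt0// invr_gt0.
  have [a Na aP] := near n _ N.+1 d0; have [b ab bP] := near n _ a.+1 d0.
  exists (a, b); split=> //= m mn.
  have := ler_distD (f (pt m)) (v b (pt m)) (v a (pt m)).
  have := aP m mn; have := bP m mn; rewrite (distrC (v a _)).
  by set z := _^-1 in d0 *; lra.
have all (nN : nat * nat) := step nN.1 nN.2.
have [F FP] := choice all.
pose p := fix p n := if n is n'.+1 then F (n, (p n').2) else F (0, 0)%N.
have pP n : exists N, p n = F (n, N) /\ forall k, n = k.+1 -> N = (p k).2.
  by case: n => [|n]; [exists 0%N|exists (p n).2; split=> // k [->]].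
exists (fun k => (p k).1), (fun k => (p k).2); split=> [k|m].
  apply/andP; split; first by have [N [-> _]] := pP k; have [] := FP (k, N).
  by have [N [-> /(_ k erefl) <-]] := pP k.+1; have [] := FP (k.+1, N).
apply/cvgrPdist_le => eps eps0.
near=> k; rewrite sub0r normrN.
have [N [-> _]] := pP k; have [_ _ /(_ m)] := FP (k, N).
move=> /= H; apply: le_trans (H _) _.
  by near: k; exact: nbhs_infty_gt.
rewrite invf_ple ?posrE// ltW// -[ltRHS]/(k.+1%:R).
have : (Num.bound eps^-1 <= k)%N by near: k; exact: nbhs_infty_ge.
move=> ek; apply: lt_le_trans (archi_boundP _) _; first by rewrite invr_ge0 ltW.
by rewrite ler_nat ltnW.
Unshelve. all: by end_near. Qed.

Section ell1_basis.
Context {R : realType}.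

Lemma finite_support_ell1 (u : nat -> R) N : (forall n, (N <= n)%N -> u n = 0) ->
  ell1 R u /\ ell1_norm u = \sum_(0 <= k < N) `|u k|.
Proof.
move=> u0; have c : [normed series u] @ \oo --> \sum_(0 <= k < N) `|u k|.
  apply: cvg_near_cst; exists N => // n /= Nn.
  rewrite /series/= (big_cat_nat (n := N))//= [X in _ + X]big_nat [X in _ + X]big1 ?addr0//.
  by move=> k /andP[Nk _]; rewrite u0 ?normr0.
by split; [apply/cvg_ex; eexists; exact: c|exact/cvg_lim].
Qed.

(** Apply Simons' argument to differences of the images of the unit vectors: some element of their
    hull is shorter than [c]. But on the sequences behind these differences, summing the
    coefficients over the range of [b] gives 1, hence also on the hull, so the ell1 norm is at least
    1 there and the image has norm at least [c]. *)
Lemma not_contains_ell1 (V : completeNormedModType R) (X : Type) (ev : X -> V -> R) :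
  (forall x, scalar (ev x)) -> (forall x v, `|ev x v| <= `|v|) ->
  (forall v, v != 0 -> exists x, `|v| <= `|ev x v|) ->
  (forall (v : nat -> V) C, (forall k, `|v k| <= C) -> X ->
    exists a b : nat -> nat, (forall k, (a k < b k < a k.+1)%N) /\
      forall x, (fun k => ev x (v (b k) - v (a k))) @ \oo --> (0 : R)) ->
  ~ contains_ell1 V.
Proof.
move=> evl ev1 att pairs [T Tl [c [C [c0 TC]]]].
pose e k : nat -> R := fun n => (n == k)%:R.
have e0 k n : (k < n)%N -> e k n = 0 by rewrite /e => kn; rewrite gtn_eqF.
have eE k : ell1 R (e k) /\ ell1_norm (e k) = 1.
  have [e1 ->] := finite_support_ell1 (e0 k); split=> //.
  rewrite big_nat_recr//= big_nat big1 => [|n /andP[_ nk]].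
    by rewrite add0r /e eqxx normr1.
  by rewrite /e ltn_eqF// normr0.
have TC1 k : `|T (e k)| <= C.
  by have [e1 en] := eE k; have := TC _ e1; rewrite en !mulr1 => /andP[].
have Te0 : T (e 0%N) != 0.
  rewrite -normr_gt0; have [e1 en] := eE 0%N; have := TC _ e1.
  by rewrite en mulr1 => /andP[/(lt_le_trans c0)].
have [x0 _] := att _ Te0.
have [a [b [ab wk]]] := pairs _ _ TC1 x0.
have bS k : (b k < b k.+1)%N.
  by have /andP[_ h1] := ab k; have /andP[h2 _] := ab k.+1; exact: ltn_trans h1 h2.
have bmono : {homo b : i j / (i < j)%N} by exact: homo_ltn ltn_trans bS.
have ble : {homo b : i j / (i <= j)%N} by exact: ltnW_homo bmono.
have nab k l : a k <> b l.
  move=> abkl; have [kl|lk] := leqP k l.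
    by have := ble _ _ kl; rewrite -abkl leqNgt; have /andP[->] := ab k.
  have := ab k.-1; rewrite (ltn_predK lk) => /andP[_].
  by rewrite abkl ltnNge ble// -ltnS (ltn_predK lk).
(* The indicator of the range of [b], which by [nab] misses the range of [a]. *)
pose sg j : R := `[< exists k, b k = j >]%:R.
pose Q (v : V) := exists u N, [/\ v = T u, forall n, (N <= n)%N -> u n = 0 &
  forall M, (N <= M)%N -> \sum_(0 <= j < M) sg j * u j = 1].
have se k M : (k < M)%N -> \sum_(0 <= j < M) sg j * e k j = sg k.
  move=> kM; rewrite (bigD1_seq k)/= ?mem_index_iota ?iota_uniq//.
  by rewrite /e eqxx mulr1 big1 ?addr0// => j /negbTE ->; rewrite mulr0.
have Qw k : Q (T (e (b k)) - T (e (a k))).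
  exists (fun n => -1 * e (a k) n + e (b k) n), (b k).+1.
  have /andP[akb _] := ab k; split.
  - rewrite Tl; [|exact: (eE _).1|exact: (eE _).1].
    by rewrite scaleN1r addrC.
  - by move=> n bn; rewrite !e0 ?mulr0 ?addr0//; exact: ltn_trans bn.
  - move=> M bM; have aM := ltn_trans akb bM.
    rewrite (eq_bigr (fun j => -1 * (sg j * e (a k) j) + sg j * e (b k) j)); last first.
      by move=> j _; ring.
    rewrite big_split/= -mulr_sumr !se// /sg.
    rewrite asboolF => [|[l /esym/nab]//]; rewrite asboolT; last by exists k.
    by rewrite mulr0 add0r.
have Qmid u v : Q u -> Q v -> Q (2^-1 *: (u + v)).
  move=> [f [N [-> f0 f1]]] [g [M [-> g0 g1]]].
  have z0 : ell1 R (fun=> 0) by have [] := @finite_support_ell1 (fun=> 0) 0%N.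
  have T0 : T (fun=> 0) = 0.
    have := Tl 1 _ _ z0 z0; rewrite scale1r (_ : (fun _ => _) = fun=> 0).
      by move/eqP; rewrite -subr_eq subrr => /eqP.
    by apply/funext => n; rewrite mulr0 addr0.
  have fe := (finite_support_ell1 f0).1; have ge := (finite_support_ell1 g0).1.
  have hge : ell1 R (fun n => 2^-1 * g n + 0).
    by apply: (finite_support_ell1 (N := M) _).1 => n Mn; rewrite g0// mulr0 addr0.
  exists (fun n => 2^-1 * f n + (2^-1 * g n + 0)), (maxn N M); split.
  - by rewrite Tl// Tl// T0 addr0 scalerDr.
  - by move=> n; rewrite geq_max => /andP[? ?]; rewrite f0// g0// !mulr0 !addr0.
  - move=> n; rewrite geq_max => /andP[Nn Mn].
    rewrite (eq_bigr (fun j => 2^-1 * (sg j * f j) + 2^-1 * (sg j * g j))); last first.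
      by move=> j _; ring.
    by rewrite big_split/= -!mulr_sumr f1// g1//; field.
have w2 k : `|T (e (b k)) - T (e (a k))| <= C + C.
  by rewrite (le_trans (ler_normB _ _))// lerD.
have att' v : exists x, `|v| <= `|ev x v|.
  by have [->|/att//] := eqVneq v 0; exists x0; rewrite normr0.
have [v hv] := tail_hull_small evl ev1 att' w2 wk c0.
have [u [N [-> u0 u1]]] : Q v.
  by elim: hv => [k _|? ? _ + _]; [exact: Qw|exact: Qmid].
have [ue un] := finite_support_ell1 u0.
rewrite ltNge; apply/negP/negPn; have /andP[+ _] := TC _ ue; apply: le_trans.
rewrite -[leLHS]mulr1 ler_pM2l// un -(u1 N (leqnn N)).
rewrite (le_trans (ler_norm _))// (le_trans (ler_norm_sum _ _ _))//.
apply: ler_sum => j _; rewrite normrM ler_piMl// /sg.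
by case: asbool; rewrite ?normr1 ?normr0.
Qed.

End ell1_basis.

(** * Embedding into a dual *)

Section weighted_sum.
Context {R : realType}.

(** The weights add up to 1, so a sequence bounded by [M] has a sum bounded by [M]. *)
Definition wsum (u : nat -> R) : R := limn (series (fun i => 2^-1 ^+ i.+1 * u i)).

Lemma wsum_cvg (u : nat -> R) M : (forall i, `|u i| <= M) ->
  cvgn (series (fun i => 2^-1 ^+ i.+1 * u i)).
Proof.
move=> uM; apply: normed_cvg.
apply: (@series_le_cvg R _ (fun i => M * 2^-1 ^+ i)) => [i|i|i|].
- exact: normr_ge0.
- by rewrite mulr_ge0 ?exprn_ge0 ?invr_ge0// (le_trans _ (uM i)).
- rewrite /= normrM ger0_norm ?exprn_ge0 ?invr_ge0// mulrC.
  have h0 : 0 <= 2^-1 ^+ i.+1 :> R by rewrite exprn_ge0// invr_ge0.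
  have h1 : 2^-1 ^+ i.+1 <= 2^-1 ^+ i :> R.
    by rewrite exprS ler_piMl ?exprn_ge0 ?invr_ge0// invf_le1// ler1n.
  exact: ler_pM.
- apply: is_cvg_geometric_series.
  by rewrite ger0_norm ?invr_ge0// invf_lt1// ltr1n.
Qed.

Lemma wsum_tail (u : nat -> R) M N : (forall i, `|u i| <= M) ->
  `|wsum u - series (fun i => 2^-1 ^+ i.+1 * u i) N| <= M * 2^-1 ^+ N.
Proof.
move=> uM; have M0 : 0 <= M by exact: le_trans (uM 0%N).
have cu := wsum_cvg uM; set s := series _ in cu *.
have c : (fun n => `|s n - s N|) @ \oo --> `|wsum u - s N|.
  by apply: cvg_norm; apply: cvgB; [exact: cu|exact: cvg_cst].
apply: (cvgr_to_le c); exists N => // n /= Nn.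
suff : `|s n - s N| <= M * (2^-1 ^+ N - 2^-1 ^+ n).
  move=> h1; apply: le_trans h1 _; rewrite ler_wpM2l// gerBl.
  by rewrite exprn_ge0// invr_ge0.
rewrite -(subnK Nn); elim: (n - N)%N => [|k IHk].
  by rewrite add0n !subrr mulr0 normr0.
have sS : s (k.+1 + N)%N = s (k + N)%N + 2^-1 ^+ (k + N).+1 * u (k + N)%N.
  by rewrite addSn /s /series/= big_nat_recr.
rewrite sS; set x := s (k + N)%N in IHk *; set t := (2^-1 : R) ^+ (k + N).+1.
have tE : 2^-1 ^+ (k + N) = 2 * t :> R.
  by rewrite /t exprS mulrA mulfV// mul1r.
rewrite tE in IHk.
have t0 : 0 <= t by rewrite exprn_ge0// invr_ge0.
have h1 : `|t * u (k + N)%N| <= M * t.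
  by rewrite normrM ger0_norm// mulrC ler_wpM2r.
have := ler_normD (x - s N) (t * u (k + N)%N).
rewrite addrAC; lra.
Qed.

Lemma wsum_lin (a : R) (u v : nat -> R) M M' :
  (forall i, `|u i| <= M) -> (forall i, `|v i| <= M') ->
  wsum (fun i => a * u i + v i) = a * wsum u + wsum v.
Proof.
move=> uM vM; apply/cvg_lim => //.
rewrite (_ : series _ = fun n => a * series (fun i => 2^-1 ^+ i.+1 * u i) n +
    series (fun i => 2^-1 ^+ i.+1 * v i) n); last first.
  apply/funext => n; rewrite /series/= mulr_sumr -big_split/=.
  by apply: eq_bigr => i _; ring.
apply: cvgD; last exact: wsum_cvg vM.
by apply: cvgM; [exact: cvg_cst|exact: wsum_cvg uM].
Qed.

Lemma wsum1 (u : nat -> R) i : (forall j, j != i -> u j = 0) -> wsum u = 2^-1 ^+ i.+1 * u i.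
Proof.
move=> u0; apply/cvg_lim => //; apply: cvg_near_cst; exists i.+1 => // n /= ni.
rewrite /series/= (bigD1_seq i)/= ?mem_index_iota ?iota_uniq//.
by rewrite big1 ?addr0// => j ji; rewrite u0// mulr0.
Qed.

End weighted_sum.

Section WRN_of_bumps.
Context {R : realType} {Gamma : Type} (K : set {ptws Gamma -> R}).
Hypothesis K_compact : compact K.
Hypothesis K_solid : solid K.
Variables (Gam : nat -> set Gamma) (c r : nat -> R).
Hypothesis sys : bump_system K Gam c r.

Local Notation bump := (bump Gam c r).

(** Each [i] has its own copy of [K], so that evaluation at a point of that copy meets only the
    point-finite family of bumps of index [i]. *)
Definition bump_gen (j : nat * Gamma) (s : nat * K) : R :=
  if j.1 == s.1 then bump j.1 j.2 (set_val s.2) else 0.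

Local Notation V := (cspan bump_gen).

Lemma bump_gen_le1 j s : `|bump_gen j s| <= 1.
Proof.
by rewrite /bump_gen; case: ifP => _; rewrite ?normr0// (normr_bump_le1 sys).
Qed.

Lemma bump_gen_mem j : bump_gen j \in cspan_mem bump_gen.
Proof. exact: cspan_gen_mem (bump_gen_le1 j). Qed.

Lemma restr_subproof (x : K) (g : Gamma) :
  patch (fun=> 0) [set g] (set_val x) \in K.
Proof. by apply/mem_set/K_solid; [exact: set_valP|exact: finite_set1]. Qed.

Definition restr (x : K) (g : Gamma) : K := SigSub (restr_subproof x g).

Lemma restrE x g : set_val (restr x g) = patch (fun=> 0) [set g] (set_val x).
Proof. by []. Qed.

Lemma bump_restr i g x : bump i g (set_val (restr x g)) = bump i g (set_val x).
Proof. by apply: bump_eq; rewrite restrE patchE ifT// inE. Qed.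

Lemma bump_restr0 i g h x : h <> g -> bump i h (set_val (restr x g)) = 0.
Proof.
by move=> hg; apply: (bump_at0 sys); rewrite restrE patchE ifF//; apply/negP; rewrite inE.
Qed.

Lemma cspan_bump_continuous (v : V) i : continuous (fun x : K => v (i, x)).
Proof.
apply: continuous_uniform_limit => eps eps0.
have /asboolP[_ /(_ _ eps0)[u su vu]] := cspan_valP v.
exists (fun x => u (i, x)); last by move=> x; exact: vu.
elim: su {vu} => [|a j z _ IH]; first exact: (@cst_continuous K R 0).
rewrite (_ : (fun _ => _) = fun x => a * bump_gen j (i, x) + 1 * z (i, x)); last first.
  by apply/funext => x; rewrite mul1r.
apply: continuous_lin => //; rewrite /bump_gen /=; case: eqP => _.
  by move=> x; exact: (continuous_comp (@continuous_set_val _ K x)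
    (@bump_continuous _ _ _ _ _ _ _ _)).
exact: (@cst_continuous K R 0).
Qed.

Lemma cspan_bump_tail (v : V) eps : 0 < eps ->
  exists N, forall i x, (N <= i)%N -> `|v (i, x)| <= eps.
Proof.
move=> eps0; have /asboolP[_ /(_ _ eps0)[u su vu]] := cspan_valP v.
suff [N uN] : exists N, forall i x, (N <= i)%N -> u (i, x) = 0.
  by exists N => i x Ni; have := vu (i, x); rewrite uN// subr0.
elim: su => [|a j z _ [N zN]]; first by exists 0%N.
exists (maxn j.1.+1 N) => i x; rewrite geq_max => /andP[ji Ni].
by rewrite zN// addr0 /bump_gen /= ltn_eqF// mulr0.
Qed.

(** Each copy of [K] is compact, and from some copy on [v] stays below half of its norm, so the
    supremum is a maximum over finitely many copies. *)
Lemma cspan_bump_attained (v : V) : v != 0 -> exists s, `|v| <= `|v s|.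
Proof.
rewrite -normr_gt0 => v0.
have [s0 _] : exists s0 : nat * K, True.
  apply: contrapT => ns; move: v0; rewrite ltNge; apply/negP/negPn.
  by apply: cspan_norm_le => // s; exfalso; apply: ns; exists s.
have /choice[x xP] : forall i, exists x, forall y : K, `|v (i, y)| <= `|v (i, x)|.
  move=> i; have [|||z _ zP] := @compact_EVT_max K R (fun y => `|v (i, y)|) setT.
  - by exists s0.2.
  - exact: compact_setT_set_type.
  - exact/continuous_subspaceT/continuous_normr/cspan_bump_continuous.
  - by exists z => y; apply: zP; rewrite inE.
have [N vN] := cspan_bump_tail v (divr_gt0 v0 (ltr0n _ 2)).
apply: contrapT => ns.
pose m := \big[Num.max/(`|v| / 2)]_(i < N) `|v (i : nat, x i)|.
have : `|v| <= m.
  apply: cspan_norm_le => [|[i y]].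
    by apply: (le_trans _ (bigmax_ge_id _ _ _ _)); rewrite divr_ge0.
  have [Ni|iN] := leqP N i.
    by rewrite (le_trans (vN i y Ni))// /m bigmax_ge_id.
  apply: le_trans (xP i y) _.
  exact: (le_bigmax _ (fun i : 'I_N => `|v (i : nat, x i)|) (Ordinal iN)).
rewrite leNgt; apply/negP/negPn; apply: bigmax_lt => [|i _]; first by lra.
by rewrite ltNge; apply/negP => h; apply: ns; exists (i : nat, x i).
Qed.

(** [B] lists the finitely many [g] whose bump is nonzero at [x]. The identity holds for the
    generators, as the bump of [g] sees only the coordinate [g], and [cspan_comb0] extends it. *)
Lemma cspan_bump_decomposition (i : nat) (x : K) :
  exists B : seq {classic Gamma}, forall v : V, v (i, x) = \sum_(g <- B) v (i, restr x g).
Proof.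
have /(@finite_seqP {classic Gamma})[B0 B0E] := bump_finite sys i (set_valP x).
pose B : seq {classic Gamma} := undup B0.
have BP g : (g \in B) = (bump i g (set_val x) != 0).
  rewrite mem_undup; apply/idP/idP => h.
    by have : [set` B0] g by []; rewrite -B0E.
  by have : [set g | bump i g (set_val x) != 0] g by []; rewrite B0E.
exists B => v; apply/eqP; rewrite -subr_eq0; apply/eqP.
have := @cspan_comb0 R _ _ bump_gen
  ((1, (i, x)) :: [seq (-1, (i, restr x g)) | g : {classic Gamma} <- B]) v.
rewrite big_cons big_map /= mul1r -mulr_sumr mulN1r; apply=> j.
rewrite big_cons big_map /= mul1r -mulr_sumr mulN1r /bump_gen /=.
move: (eqVneq j.1 i) => -[->|ji]; last by rewrite big1// subr0.
have [jB|jB] := boolP ((j.2 : {classic Gamma}) \in B); last first.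
  move: (jB); rewrite BP negbK => /eqP ->; rewrite sub0r big_seq big1 ?oppr0// => g gB.
  by apply: bump_restr0 => jg; move: jB; rewrite jg gB.
rewrite (bigD1_seq (j.2 : {classic Gamma}))//= ?undup_uniq//.
rewrite big1 => [|g /eqP gj]; first by rewrite addr0 bump_restr subrr.
by apply: bump_restr0 => jg; apply: gj.
Qed.

(** For fixed [(i, g)] all evaluations at restricted points are multiples of one functional, so a
    single [y] with a nonzero bump controls every [x]. *)
Lemma cspan_bump_proportional (v : V) i g x y :
  bump i g (set_val y) * v (i, restr x g) = bump i g (set_val x) * v (i, restr y g).
Proof.
apply/eqP; rewrite -subr_eq0 -mulNr; apply/eqP.
have := @cspan_comb0 R _ _ bump_gen [:: (bump i g (set_val y), (i, restr x g));
  (- bump i g (set_val x), (i, restr y g))] v.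
rewrite !big_cons !big_nil /= addr0; apply=> -[i' h].
rewrite !big_cons !big_nil /= addr0 /bump_gen /=.
have [->|_] := eqVneq i' i; last by rewrite !mulr0 addr0.
have [->|hg] := pselect (h = g); first by rewrite !bump_restr; ring.
by rewrite !bump_restr0// !mulr0 addr0.
Qed.

Lemma cspan_bump_eq0 (v : V) i g x :
  bump i g (set_val x) = 0 -> v (i, restr x g) = 0.
Proof.
move=> b0; have := @cspan_comb0 R _ _ bump_gen [:: (1, (i, restr x g))] v.
rewrite big_seq1 /= mul1r; apply=> -[i' h].
rewrite big_seq1 /= mul1r /bump_gen /=; case: eqP => // ->.
have [->|hg] := pselect (h = g); first by rewrite bump_restr.
exact: bump_restr0.
Qed.

(** A finite combination of generators vanishes at the restricted points of all but finitely many
    pairs; approximate [v] within [1 / n.+1] for each [n]. *)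
Lemma cspan_bump_countable (v : V) :
  countable [set j : nat * Gamma | exists x, v (j.1, restr x j.2) != 0].
Proof.
have approx n : exists A : set (nat * Gamma), finite_set A /\
    forall j x, ~ A j -> `|v (j.1, restr x j.2)| <= n.+1%:R^-1.
  have n0 : (0 : R) < n.+1%:R^-1 by rewrite invr_gt0.
  have /asboolP[_ /(_ _ n0)[u su vu]] := cspan_valP v.
  suff [A [fA uA]] : exists A : set (nat * Gamma), finite_set A /\
      forall j x, ~ A j -> u (j.1, restr x j.2) = 0.
    exists A; split=> // j x Aj; have := vu (j.1, restr x j.2).
    by rewrite uA// subr0.
  elim: su => [|a k z _ [A [fA zA]]]; first by exists set0.
  exists (k |` A); split=> [|j x /not_orP[jk jA]].
    by rewrite finite_setU; split=> //; exact: finite_set1.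
  rewrite zA// addr0 /bump_gen /=; case: eqP => [kj|]; last by rewrite mulr0.
  rewrite bump_restr0 ?mulr0// => k2; apply: jk.
  by rewrite [j]surjective_pairing [k]surjective_pairing /= kj k2.
have [A AP] := choice approx.
apply: (@sub_countable _ _ _ (\bigcup_n A n)).
  apply: subset_card_le => j [x vx]; apply: contrapT => nA; move/eqP: vx; apply.
  apply/eqP; rewrite -normr_le0 leNgt; apply/negP => v0.
  have [n nv] : exists n, n.+1%:R^-1 < `|v (j.1, restr x j.2)|.
    exists (Num.bound `|v (j.1, restr x j.2)|^-1).
    rewrite invf_plt ?posrE// (lt_trans (archi_boundP _))// ?invr_ge0//.
    by rewrite ltr_nat.
  have [_ /(_ j x)] := AP n; rewrite leNgt nv => h; suff : false by [].
  by apply: h => Aj; apply: nA; exists n.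
by apply: bigcup_countable => // n _; apply: finite_set_countable; have [] := AP n.
Qed.

(** Only countably many pairs [(i, g)] matter for the whole sequence. With one point for each of
    them [close_pairs] applies, and the convergence spreads to every point by proportionality and
    decomposition. *)
Lemma cspan_bump_pairs (v : nat -> V) C : (forall k, `|v k| <= C) -> (nat * K)%type ->
  exists a b : nat -> nat, (forall k, (a k < b k < a k.+1)%N) /\
    forall s, (fun k => (v (b k) - v (a k)) s) @ \oo --> (0 : R).
Proof.
move=> vC s0.
pose D := \bigcup_k [set j : nat * Gamma | exists x, v k (j.1, restr x j.2) != 0].
have cD : countable D.
  by apply: bigcup_countable => // k _; exact: cspan_bump_countable.
have /countable_injP[e eI] := cD.
(* [s0] is a default for the numbers that code no pair of [D]. *)
have pts n : exists s, forall j, D j -> e j = n ->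
    exists y, s = (j.1, restr y j.2) /\ bump j.1 j.2 (set_val y) != 0.
  have [[j [Dj jn]]|nj] := pselect (exists j, D j /\ e j = n); last first.
    by exists s0 => j Dj jn; exfalso; apply: nj; exists j.
  have [k _ [y vy]] := Dj.
  exists (j.1, restr y j.2) => j' Dj' jn'.
  have -> : j' = j by apply: eI; rewrite ?inE// jn jn'.
  by exists y; split=> //; apply: contra_neqN vy => /eqP b0; exact: cspan_bump_eq0.
have [pt ptP] := choice pts.
have vC' k s : `|v k s| <= C by exact: le_trans (ler_cspan_norm _ _) (vC k).
have [a [b [ab cv]]] := close_pairs pt vC'.
exists a, b; split=> // -[i x].
have [B BP] := cspan_bump_decomposition i x.
rewrite (_ : (fun _ => _) = fun k => \sum_(g <- B) (v (b k) - v (a k)) (i, restr x g)); last first.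
  by apply/funext => k; exact: BP.
suff cg g : (fun k => (v (b k) - v (a k)) (i, restr x g)) @ \oo --> (0 : R).
  elim: B {BP} => [|g B IHB].
    rewrite (_ : (fun _ => _) = fun=> 0); first exact: cvg_cst.
    by apply/funext => k; rewrite big_nil.
  rewrite (_ : (fun _ => _) = fun k => (v (b k) - v (a k)) (i, restr x g) +
      \sum_(g <- B) (v (b k) - v (a k)) (i, restr x g)); last first.
    by apply/funext => k; rewrite big_cons.
  by have := cvgD (cg g) IHB; rewrite addr0; apply.
have [Dg|nDg] := pselect (D (i, g)); last first.
  rewrite (_ : (fun _ => _) = fun=> 0); first exact: cvg_cst.
  apply/funext => k; have v0 l : v l (i, restr x g) = 0.
    apply: contrapT => /eqP vl; apply: nDg; exists l => //; by exists x.
  by rewrite -[LHS]/(v (b k) _ - v (a k) _) !v0 subrr.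
have [y [ptE by0]] := ptP _ _ Dg erefl.
rewrite (_ : (fun _ => _) = fun k => bump i g (set_val x) / bump i g (set_val y) *
    (v (b k) (pt (e (i, g))) - v (a k) (pt (e (i, g))))); last first.
  apply/funext => k; rewrite ptE -[X in _ = _ * X]/((v (b k) - v (a k)) _).
  apply: (mulfI by0); rewrite cspan_bump_proportional.
  by rewrite [in RHS]mulrA [bump i g (set_val y) * _]mulrC divfK.
rewrite -(mulr0 (bump i g (set_val x) / bump i g (set_val y))).
by apply: cvgM; [exact: cvg_cst|exact: cv].
Qed.

Lemma cspan_bump_no_ell1 : ~ contains_ell1 V.
Proof.
apply: (@not_contains_ell1 R V (nat * K)%type (fun s v => v s)) => //.
- by move=> s v; exact: ler_cspan_norm.
- exact: cspan_bump_attained.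
- exact: cspan_bump_pairs.
Qed.

(** A point [x] acts on [V] by the weighted sum of its evaluations in all copies of [K]. The series
    converges uniformly in [x], which gives continuity, and its value at a generator is a multiple
    of a bump, which gives injectivity. *)
Lemma bump_system_WRN : WRN R K.
Proof.
exists V; split; first exact: cspan_bump_no_ell1.
pose F (x : K) : {ptws V -> R} := fun v => wsum (fun i => v (i, x)).
have vle (v : V) x i : `|v (i, x)| <= `|v| by exact: ler_cspan_norm.
have Fd x : F x \in dual V.
  apply/mem_set/(@bound_dual _ _ _ 1) => [a u v|v].
    exact: wsum_lin (vle u x) (vle v x).
  by have := wsum_tail 0 (vle v x); rewrite /series/= big_geq// subr0 expr0 mulr1 mul1r.
pose f x : dual V := SigSub (Fd x).
have cf : continuous f.
  apply: continuous_set_type; apply: continuous_ptws => v.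
  apply: continuous_uniform_limit => eps eps0.
  have [N Ne] : exists N, `|v| * 2^-1 ^+ N <= eps.
    have half1 : `|2^-1 : R| < 1 by rewrite ger0_norm ?invf_lt1 ?ltr1n// invr_ge0.
    have v1 : 0 < `|v| + 1 by rewrite ltr_wpDl.
    have /cvgrPdist_lt/(_ _ (divr_gt0 eps0 v1))[N _ /(_ N (leqnn N))] := cvg_expr half1.
    rewrite /= sub0r normrN ger0_norm ?exprn_ge0 ?invr_ge0// ltr_pdivlMr// => HN.
    exists N; rewrite mulrC; apply: le_trans (ltW HN).
    by apply: ler_wpM2l; [rewrite exprn_ge0// invr_ge0|rewrite lerDl].
  exists (fun x => series (fun i => 2^-1 ^+ i.+1 * v (i, x)) N); last first.
    by move=> x; apply: le_trans (wsum_tail N (vle v x)) Ne.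
  elim: N {Ne} => [|N IHN].
    rewrite (_ : (fun _ => _) = fun=> 0); first exact: (@cst_continuous K R 0).
    by apply/funext => x; rewrite /series/= big_geq.
  rewrite (_ : (fun _ => _) = fun x => 1 * series (fun i => 2^-1 ^+ i.+1 * v (i, x)) N +
      2^-1 ^+ N.+1 * v (N, x)).
    by apply: continuous_lin => //; exact: cspan_bump_continuous.
  by apply/funext => x; rewrite /series/= big_nat_recr//= mul1r.
have fI : injective f.
  move=> x y fxy; apply: val_inj.
  apply: (bump_separating sys); [exact: set_valP|exact: set_valP|] => i g.
  have : F x (CSpan (bump_gen_mem (i, g))) = F y (CSpan (bump_gen_mem (i, g))).
    by rewrite -[F x]/(set_val (f x)) fxy.
  have one z : F z (CSpan (bump_gen_mem (i, g))) = 2^-1 ^+ i.+1 * bump i g (set_val z).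
    rewrite /F (@wsum1 _ _ i) => [|j ji]; first by rewrite /= /bump_gen /= eqxx.
    by rewrite /= /bump_gen /= eq_sym (negbTE ji).
  by rewrite !one => /mulfI; apply; rewrite expf_neq0.
have hd : hausdorff_space (dual V).
  apply: (@hausdorff_separating R) => u v uv; apply: contrapT => nh; apply: uv.
  apply: val_inj; apply/funext => w; apply: contrapT => uvw; apply: nh.
  exists (fun phi : dual V => set_val phi w : R) => //.
  move=> phi; exact: (continuous_comp (@continuous_set_val _ (dual V) phi)
    (@continuous_ptws_eval V R w _)).
have cKT := compact_setT_set_type K_compact.
have [h hh _] := homeomorphic_range cKT hd cf fI.
exists (range f); split; first exact: compact_range.
by exists h.
Qed.

End WRN_of_bumps.

Theorem theorem2p12 (R : realType) (Gamma : Type) (K : set {ptws Gamma -> R})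
    (K_Sigma : K `<=` Sigma_product R Gamma) (K_compact : compact K)
    (K_solid : solid K) :
  (WRN R K <-> QWRN R K) /\ (QWRN R K <-> Eberlein R K).
Proof.
have hK : hausdorff_space K.
  apply: (@hausdorff_separating R) => x y xy; apply: contrapT => nh; apply: xy.
  apply: val_inj; apply/funext => g; apply: contrapT => xyg; apply: nh.
  exists (fun z : K => set_val z g : R) => //.
  move=> z; exact: (continuous_comp (@continuous_set_val _ K z)
    (@continuous_ptws_eval Gamma R g _)).
split; split.
- exact: WRN_QWRN.
- move=> /(QWRN_bump_system_nat K_solid)[Gam [c [r sys]]].
  exact: bump_system_WRN sys.
- move=> /(QWRN_bump_system_nat K_solid)[Gam [c [r sys]]].
  exact: bump_system_Eberlein sys.
- exact: Eberlein_QWRN.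
Qed.
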